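(* Let $\mathcal C$ be a semisimple strict rigid C*-tensor category with at most countably many isomorphism classes of simple objects, let $\Lambda\subseteq[Obj(\mathcal C)]$ be a full weight set, let $\mathcal A\Lambda$ be the annular algebra with weight set $\Lambda$ and $\mathcal A$ the tube algebra of $\mathcal C$, and let $I$ be a countably infinite set. Then $F(I)\otimes\mathcal A\cong F(I)\otimes\mathcal A\Lambda$ as $*$-algebras.
   Context: Categories. $\mathcal C$ is a C*-category with finite-dimensional morphism spaces $Mor(X,Y)$, finite direct sums and subobjects, a strict tensor functor $\otimes$ compatible with $*$, simple tensor unit $id$, duals, and at most countably many isomorphism classes of simple objects. $\mathrm{Irr}(\mathcal C)$ is the set of isomorphism classes of simple objects, $X_k$ a chosen representative of $k\in \mathrm{Irr}(\mathcal C)$, $0$ the class of the unit, $X_0=id$. $[Obj(\mathcal C)]$ is the set of isomorphism classes of objects. $R_k\in Mor(id,\overline X_k\otimes X_k)$, $\overline R_k\in Mor(id,X_k\otimes\overline X_k)$ are standard solutions of the conjugate equations, with $\overline X_k$ identified with $X_{\overline k}$. Annular algebra. For a weight set $\Lambda\subseteq[Obj(\mathcal C)]$ with chosen representatives $Y_i\in i$ ($i\in\Lambda$), $\mathcal A\Lambda=\bigoplus_{i,j\in\Lambda,\,k\in \mathrm{Irr}(\mathcal C)}\mathcal A\Lambda^k_{i,j}$, $\mathcal A\Lambda^k_{i,j}=Mor(X_k\otimes Y_i,Y_j\otimes X_k)$. It is a $*$-algebra with product $$(x\cdot y)^k_{i,j}=\sum_{s\in\Lambda,\ m,l\in \mathrm{Irr}(\mathcal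 C)}\ \sum_{V\in onb(X_k,X_m\otimes X_l)}(1_j\otimes V^* )(x^m_{s,j}\otimes 1_l)(1_m\otimes y^l_{i,s})(V\otimes 1_i)$$ and involution $$(x^\#)^k_{i,j}=(\overline R_k^*\otimes 1_j\otimes 1_k)(1_k\otimes (x^{\overline k}_{j,i})^*\otimes 1_k)(1_k\otimes 1_i\otimes R_k),$$ where $onb(X_k,\beta)$ is an orthonormal basis of $Mor(X_k,\beta)$ for the inner product $\eta^*\xi=\langle\xi,\eta\rangle 1_{X_k}$. The tube algebra $\mathcal A$ is the annular algebra with weight set $\mathrm{Irr}(\mathcal C)$. $\Lambda$ is full if every simple object is isomorphic to a subobject of some $Y_i$, $i\in\Lambda$. For a set $I$, $F(I)$ is the $*$-algebra spanned by the matrix units $\{E_{i,j}\in B(\ell^2(I)): i,j\in I\}$ relative to the standard orthonormal basis of $\ell^2(I)$. *)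

(* Defs.v *)
From HB Require Import structures.
From mathcomp Require Import all_boot all_order all_algebra generic_quotient.
From mathcomp Require Import finmap boolp classical_sets functions cardinality fsbigop.

Set Implicit Arguments.
Unset Strict Implicit.
Unset Printing Implicit Defensive.

Import Order.TTheory GRing.Theory Num.Theory.
Local Open Scope classical_set_scope.
Local Open Scope ring_scope.

(* The scalars are an abstract [K : numClosedFieldType]; the intended instance
   is [K := R[i]] with [R : realType]. As for [`|c| : K], norms are nonnegative
   elements of [K]. *)

Reserved Notation "f ∘ g" (at level 40, left associativity).
Reserved Notation "X ⊗ Y" (at level 35, no associativity).
Reserved Notation "f ⊠ g" (at level 35, no associativity).
Reserved Notation "f ^†" (at level 1, format "f ^†").

(* Morphism spaces are complete for [nrm] because they are finite-dimensional. *)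
Record cstarCat (K : numClosedFieldType) := CstarCat {
  obj :> Type;
  mor : obj -> obj -> vectType K;
  idm : forall X, mor X X;
  comp : forall X Y Z, mor Y Z -> mor X Y -> mor X Z
    where "f ∘ g" := (comp f g);
  adj : forall X Y, mor X Y -> mor Y X
    where "f ^†" := (adj f);
  nrm : forall X Y, mor X Y -> K;
  compA : forall X Y Z W (f : mor Z W) (g : mor Y Z) (h : mor X Y),
    f ∘ (g ∘ h) = (f ∘ g) ∘ h;
  comp1m : forall X Y (f : mor X Y), idm Y ∘ f = f;
  compm1 : forall X Y (f : mor X Y), f ∘ idm X = f;
  comp_linl : forall X Y Z (g : mor X Y), linear (fun f : mor Y Z => f ∘ g);
  comp_linr : forall X Y Z (f : mor Y Z), linear (fun g : mor X Y => f ∘ g);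
  adjK : forall X Y (f : mor X Y), f^†^† = f;
  adj_comp : forall X Y Z (f : mor Y Z) (g : mor X Y), (f ∘ g)^† = g^† ∘ f^†;
  adj_semilin : forall X Y (c : K) (f g : mor X Y),
    (c *: f + g)^† = Num.conj c *: f^† + g^†;
  nrm_ge0 : forall X Y (f : mor X Y), 0 <= nrm f;
  nrm_eq0 : forall X Y (f : mor X Y), nrm f = 0 -> f = 0;
  nrmD : forall X Y (f g : mor X Y), nrm (f + g) <= nrm f + nrm g;
  nrmZ : forall X Y (c : K) (f : mor X Y), nrm (c *: f) = `|c| * nrm f;
  nrm_comp : forall X Y Z (f : mor Y Z) (g : mor X Y),
    nrm (f ∘ g) <= nrm f * nrm g;
  nrm_adj_comp : forall X Y (f : mor X Y), nrm (f^† ∘ f) = nrm f ^+ 2;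
  (* f^* f is a positive element of the C*-algebra Mor(X, X) *)
  adj_comp_pos : forall X Y (f : mor X Y),
    exists g : mor X X, f^† ∘ f = g^† ∘ g
}.

Notation "f ∘ g" := (comp f g).
Notation "f ^†" := (adj f).
Arguments idm {K c} X : rename.

Section CstarCat.
Context {K : numClosedFieldType} {C : cstarCat K}.
Implicit Types X Y Z : C.

(* In strict tensor categories the associators and unitors are the morphisms
   [ident e] along the equalities of objects [e]. *)
Definition ident X Y (e : X = Y) : mor X Y :=
  let: erefl := e in idm X.

Definition simple X := idm X != 0 /\ forall f : mor X X, exists c, f = c *: idm X.

Definition isomorphic X Y :=
  exists (f : mor X Y) (g : mor Y X), g ∘ f = idm X /\ f ∘ g = idm Y.

Definition isometry X Y (v : mor X Y) := v^† ∘ v = idm X.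

(* Z is isomorphic to a subobject of X *)
Definition subobject Z X := exists v : mor Z X, isometry v.

Lemma comp0m X Y Z (g : mor X Y) : (0 : mor Y Z) ∘ g = 0.
Proof. by have := comp_linl g (-1) 0 (0 : mor Y Z); rewrite scaler0 addr0 scaleN1r addNr. Qed.

Lemma compm0 X Y Z (f : mor Y Z) : f ∘ (0 : mor X Y) = 0.
Proof. by have := comp_linr f (-1) 0 (0 : mor X Y); rewrite scaler0 addr0 scaleN1r addNr. Qed.

Lemma compZl X Y Z c (f : mor Y Z) (g : mor X Y) : (c *: f) ∘ g = c *: (f ∘ g).
Proof. by have := comp_linl g c f 0; rewrite addr0 comp0m addr0. Qed.

Lemma compZr X Y Z c (f : mor Y Z) (g : mor X Y) : f ∘ (c *: g) = c *: (f ∘ g).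
Proof. by have := comp_linr f c g 0; rewrite addr0 compm0 addr0. Qed.

Lemma compPl X Y Z c (f f' : mor Y Z) (g : mor X Y) :
  (c *: f + f') ∘ g = c *: (f ∘ g) + f' ∘ g.
Proof. exact: comp_linl. Qed.

Lemma compPr X Y Z c (f : mor Y Z) (g g' : mor X Y) :
  f ∘ (c *: g + g') = c *: (f ∘ g) + f ∘ g'.
Proof. exact: comp_linr. Qed.

Lemma adj0 X Y : (0 : mor X Y)^† = 0.
Proof.
have := adj_semilin (-1) (0 : mor X Y) 0.
by rewrite scaler0 addr0 rmorphN rmorph1 scaleN1r addNr.
Qed.

Lemma adj_comp_eq0 X Y (f : mor X Y) : f^† ∘ f = 0 -> f = 0.
Proof.
move=> f0; apply: nrm_eq0; apply/eqP; rewrite -sqrf_eq0 -nrm_adj_comp f0.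
by have := nrmZ 0 (0 : mor X X); rewrite scale0r normr0 mul0r => ->.
Qed.

Lemma isomorphic_trans X Y Z : isomorphic X Y -> isomorphic Y Z -> isomorphic X Z.
Proof.
move=> [f [f' [ff ff']]] [g [g' [gg gg']]]; exists (g ∘ f), (f' ∘ g').
split; first by rewrite compA -(compA f') gg compm1.
by rewrite compA -(compA g) ff' compm1.
Qed.

Lemma isomorphic_sym X Y : isomorphic X Y -> isomorphic Y X.
Proof. by move=> [f [f' [ff ff']]]; exists f', f. Qed.

Lemma simple_nonzero_iso X Y (f : mor X Y) :
  simple X -> simple Y -> f != 0 -> isomorphic X Y.
Proof.
move=> [_ sX] [_ sY] /eqP f0.
have [a fa] := sX (f^† ∘ f); have [b fb] := sY (f ∘ f^†).
have a0 : a != 0.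
  by apply: contra_notN f0 => /eqP a0; apply: adj_comp_eq0; rewrite fa a0 scale0r.
have /eqP : (b - a) *: f = 0.
  by rewrite scalerBl -{1}(comp1m f) -compZl -fb -compA fa compZr compm1 subrr.
rewrite scaler_eq0 => /orP[|/eqP//]; rewrite subr_eq0 => /eqP ba.
exists f, (a^-1 *: f^†).
by rewrite compZl fa compZr fb ba !scalerA mulVf // !scale1r.
Qed.

End CstarCat.

Arguments simple {K C} X.

Record cstarTensorCat (K : numClosedFieldType) := CstarTensorCat {
  tc_cat :> cstarCat K;
  tob : tc_cat -> tc_cat -> tc_cat
    where "X ⊗ Y" := (tob X Y);
  tmor : forall X X' Y Y', mor X X' -> mor Y Y' -> mor (X ⊗ Y) (X' ⊗ Y')
    where "f ⊠ g" := (tmor f g);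
  tunit : tc_cat;
  tmor_linl : forall X X' Y Y' (g : mor Y Y'), linear (fun f : mor X X' => f ⊠ g);
  tmor_linr : forall X X' Y Y' (f : mor X X'), linear (fun g : mor Y Y' => f ⊠ g);
  tmor1 : forall X Y, idm X ⊠ idm Y = idm (X ⊗ Y);
  tmor_comp : forall X X' X'' Y Y' Y''
    (f' : mor X' X'') (f : mor X X') (g' : mor Y' Y'') (g : mor Y Y'),
    (f' ∘ f) ⊠ (g' ∘ g) = (f' ⊠ g') ∘ (f ⊠ g);
  tmor_adj : forall X X' Y Y' (f : mor X X') (g : mor Y Y'),
    (f ⊠ g)^† = f^† ⊠ g^†;
  tobA : forall X Y Z, X ⊗ (Y ⊗ Z) = (X ⊗ Y) ⊗ Z;
  tob1l : forall X, tunit ⊗ X = X;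
  tob1r : forall X, X ⊗ tunit = X;
  tmorA : forall X X' Y Y' Z Z' (f : mor X X') (g : mor Y Y') (h : mor Z Z'),
    ident (tobA X' Y' Z') ∘ (f ⊠ (g ⊠ h)) = ((f ⊠ g) ⊠ h) ∘ ident (tobA X Y Z);
  tmor1l : forall X X' (f : mor X X'),
    ident (tob1l X') ∘ (idm tunit ⊠ f) = f ∘ ident (tob1l X);
  tmor1r : forall X X' (f : mor X X'),
    ident (tob1r X') ∘ (f ⊠ idm tunit) = f ∘ ident (tob1r X);
  tunit_simple : simple tunit;
  direct_sums : forall X Y : tc_cat,
    exists (Z : tc_cat) (u : mor X Z) (v : mor Y Z),
    [/\ isometry u, isometry v & u ∘ u^† + v ∘ v^† = idm Z];
  subobjects : forall (X : tc_cat) (p : mor X X), p ∘ p = p -> p^† = p ->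
    exists (Z : tc_cat) (v : mor Z X), isometry v /\ v ∘ v^† = p
}.

Notation "X ⊗ Y" := (tob X Y).
Notation "f ⊠ g" := (tmor f g).

Section TensorLinear.
Context {K : numClosedFieldType} {C : cstarTensorCat K}.
Implicit Types X Y : C.

Lemma tmor0m X X' Y Y' (g : mor Y Y') : (0 : mor X X') ⊠ g = 0.
Proof. by have := tmor_linl g (-1) 0 (0 : mor X X'); rewrite scaler0 addr0 scaleN1r addNr. Qed.

Lemma tmorm0 X X' Y Y' (f : mor X X') : f ⊠ (0 : mor Y Y') = 0.
Proof. by have := tmor_linr f (-1) 0 (0 : mor Y Y'); rewrite scaler0 addr0 scaleN1r addNr. Qed.

Lemma tmorPl X X' Y Y' c (f f' : mor X X') (g : mor Y Y') :
  (c *: f + f') ⊠ g = c *: (f ⊠ g) + f' ⊠ g.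
Proof. exact: tmor_linl. Qed.

Lemma tmorPr X X' Y Y' c (f : mor X X') (g g' : mor Y Y') :
  f ⊠ (c *: g + g') = c *: (f ⊠ g) + f ⊠ g'.
Proof. exact: tmor_linr. Qed.

End TensorLinear.

Section Irr.
Context {K : numClosedFieldType}.
Implicit Type C : cstarTensorCat K.

Definition conjugate_equations C (X Xb : C)
    (R : mor (tunit C) (Xb ⊗ X)) (Rb : mor (tunit C) (X ⊗ Xb)) :=
  ident (tob1l X) ∘ (Rb^† ⊠ idm X) ∘ ident (tobA X Xb X) ∘ (idm X ⊠ R)
    = ident (tob1r X) /\
  ident (tob1l Xb) ∘ (R^† ⊠ idm Xb) ∘ ident (tobA Xb X Xb) ∘ (idm Xb ⊠ Rb)
    = ident (tob1r Xb).

Definition rigid C := forall X : C,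
  exists (Xb : C) (R : mor (tunit C) (Xb ⊗ X)) (Rb : mor (tunit C) (X ⊗ Xb)),
    conjugate_equations R Rb.

(* [Obj(C)] *)
Record isoclass C := IsoClass {
  members : set C;
  membersP : exists X, members = [set Z | isomorphic X Z] }.

HB.instance Definition _ C := gen_eqMixin (isoclass C).
HB.instance Definition _ C := gen_choiceMixin (isoclass C).

Definition Irr C : set (isoclass C) := [set k | members k `<=` simple].
Arguments Irr : clear implicits.

Record weightSet C := WeightSet {
  weights :> set (isoclass C);
  rep : weights -> C;
  repP : forall i : weights, members (val i) (rep i) }.

Definition full C (L : weightSet C) :=
  forall Z : C, simple Z -> exists i : L, subobject Z (rep i).

(* For simple X, a solution is standard when its two components have the same
   norm, which is then the square root of the dimension of X. *)
Definition standard_solution C (X Xb : C)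
    (R : mor (tunit C) (Xb ⊗ X)) (Rb : mor (tunit C) (X ⊗ Xb)) :=
  conjugate_equations R Rb /\ nrm R = nrm Rb.

(* s is an orthonormal basis of Mor(X, Z), X simple, for the inner product
   <xi, eta> 1_X = eta^* xi *)
Definition is_onb C (X Z : C) (s : seq (mor X Z)) :=
  basis_of fullv s /\
  forall p q, (p < size s)%N -> (q < size s)%N ->
    (s`_p)^† ∘ s`_q = (q == p)%:R *: idm X.

(* The choices that enter the definition of the annular algebras. The dual of
   X_k is X_(bar k), so that bar k is necessarily the class of the duals of the
   members of k. *)
Record irrChoice C := IrrChoice {
  irr : Irr C -> C;
  irrP : forall k : Irr C, members (val k) (irr k);
  irr_unit : forall k : Irr C, members (val k) (tunit C) -> irr k = tunit C;
  bar : Irr C -> Irr C;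
  barK : involutive bar;
  sol : forall k, mor (tunit C) (irr (bar k) ⊗ irr k);
  solb : forall k, mor (tunit C) (irr k ⊗ irr (bar k));
  solP : forall k, standard_solution (sol k) (solb k);
  onb : forall k m l, seq (mor (irr k) (irr m ⊗ irr l));
  onbP : forall k m l, is_onb (onb k m l) }.

Definition irrWeight C (D : irrChoice C) : weightSet C :=
  @WeightSet C (Irr C) (irr D) (irrP D).

Lemma irr_simple C (D : irrChoice C) (k : Irr C) : simple (irr D k).
Proof. by have /set_mem := valP k; apply; exact: irrP. Qed.

Lemma isoclass_ext C (k k' : isoclass C) : members k = members k' -> k = k'.
Proof.
case: k k' => [S hS] [S' hS'] /= e; move: hS; rewrite e => hS.
by congr IsoClass; exact: Prop_irrelevance.
Qed.

Lemma irr_inj C (D : irrChoice C) (k k' : Irr C) :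
  isomorphic (irr D k) (irr D k') -> k = k'.
Proof.
move=> kk'; apply: val_inj; apply: isoclass_ext.
have := irrP D k; have := irrP D k'.
have [A ->] := membersP (val k); have [B ->] /= := membersP (val k') => Bk' Ak.
have AB : isomorphic A B.
  by apply: isomorphic_trans Ak (isomorphic_trans kk' (isomorphic_sym Bk')).
apply/seteqP; split=> Z /=; apply: isomorphic_trans => //.
exact: isomorphic_sym.
Qed.

Lemma onb_finite C (D : irrChoice C) (m l : Irr C) :
  finite_set [set k | onb D k m l != [::]].
Proof.
set A := [set k | _]; apply: contrapT => infA.
set Z := irr D m ⊗ irr D l.
have [B BA] := infinite_set_fset (\dim {: mor Z Z}).+1 infA.
pose V (k : Irr C) : mor (irr D k) Z := (onb D k m l)`_0.
have V_on k : k \in B -> (V k)^† ∘ V k = idm _.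
  move=> /BA Ak; have [_ /(_ 0%N 0%N)] := onbP D k m l.
  by rewrite lt0n size_eq0 => -> //; rewrite eqxx scale1r.
have V_orth k k' : k != k' -> (V k)^† ∘ V k' = 0.
  move=> /eqP kk'; apply: contrapT => /eqP; move: kk' => /[swap].
  move=> /(simple_nonzero_iso (irr_simple D k') (irr_simple D k)) /irr_inj ->.
  by [].
pose P k : mor Z Z := V k ∘ (V k)^†.
have PV k k' : k \in B -> P k' ∘ V k = (k' == k)%:R *: V k.
  move=> kB; rewrite /P -compA; have [->|nk] := eqVneq k' k.
    by rewrite V_on // compm1 scale1r.
  by rewrite V_orth // compm0 scale0r.
pose s := [tuple of map P (in_tuple (enum_fset B))].
have sE (j : 'I_(#|` B|)) : s`_j = P (tnth (in_tuple (enum_fset B)) j).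
  by rewrite -(tnth_nth 0 s) tnth_map.
have fs : free s.
  apply/freeP => a a0 i.
  pose ki := tnth (in_tuple (enum_fset B)) i.
  have kB : ki \in B by exact: mem_tnth.
  have : (\sum_(j < #|` B|) a j *: s`_j) ∘ V ki = a i *: V ki.
    pose g (f : mor Z Z) := f ∘ V ki.
    have g0 : g 0 = 0 by exact: comp0m.
    have gD : {morph g : x y / x + y >-> x + y}.
      by move=> x y; have := comp_linl (V ki) 1 x y; rewrite !scale1r.
    rewrite -/(g _) (big_morph g gD g0) (bigD1 i) //= big1 ?addr0.
      by rewrite /g compZl sE PV // eqxx scale1r.
    move=> j ji; rewrite /g compZl sE PV //.
    rewrite [_ == _](_ : _ = false) ?scale0r ?scaler0 //.
    apply/negbTE; apply: contra ji => /eqP e; apply/eqP; apply: val_inj.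
    apply/eqP; rewrite -(nth_uniq ki (ltn_ord j) (ltn_ord i) (fset_uniq B)).
    rewrite -!(tnth_nth ki (in_tuple (enum_fset B))) e; exact: eqxx.
  move=> e; have /eqP := etrans (esym e)
    (etrans (congr1 (fun f : mor Z Z => f ∘ V ki) a0) (comp0m _ _)); rewrite scaler_eq0 => /orP[/eqP//|/eqP V0].
  have [] := irr_simple D ki.
  by rewrite -V_on // V0 compm0 eqxx.
have := dimvS (subvf <<s>>%VS); move: fs => /eqP ->.
by rewrite size_tuple leqNgt => /negP.
Qed.

End Irr.

Arguments Irr {K} C _.

Definition dsum (K : nzRingType) (J : Type) (V : J -> lmodType K) :=
  {f : forall j, V j | finite_set [set j | f j != 0]}.

Section DirectSum.
Context {K : nzRingType} {J : Type} {V : J -> lmodType K}.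
Implicit Types x y z : dsum V.

HB.instance Definition _ := gen_eqMixin (dsum V).
HB.instance Definition _ := gen_choiceMixin (dsum V).

Definition coord x j : V j := sval x j.

Lemma dsumP x : finite_set [set j | coord x j != 0].
Proof. exact: svalP x. Qed.

Lemma dsum_ext x y : (forall j, coord x j = coord y j) -> x = y.
Proof. by case: x y => f fP [g gP] fg; apply: eq_exist; exact: functional_extensionality_dep. Qed.

Fact dsum_zero_subproof : finite_set [set j : J | (0 : V j) != 0].
Proof. by apply: (sub_finite_set _ (finite_set0 J)) => j /=; rewrite eqxx. Qed.
Definition dsum_zero : dsum V := exist _ (fun=> 0) dsum_zero_subproof.

Fact dsum_lin_subproof c x y :
  finite_set [set j | c *: coord x j + coord y j != 0].
Proof.
have : finite_set ([set j | coord x j != 0] `|` [set j | coord y j != 0]).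
  by rewrite finite_setU; split; exact: dsumP.
apply: sub_finite_set => j /= nz; have [xj|] := eqVneq (coord x j) 0; last by left.
by right; move: nz; rewrite xj scaler0 add0r.
Qed.
Definition dsum_lin c x y : dsum V :=
  exist _ (fun j => c *: coord x j + coord y j) (dsum_lin_subproof c x y).

Lemma coord_lin c x y j : coord (dsum_lin c x y) j = c *: coord x j + coord y j.
Proof. by []. Qed.

Let add := dsum_lin 1.
Let opp x := dsum_lin (-1) x dsum_zero.
Let scale c x := dsum_lin c x dsum_zero.

Fact dsum_addA : associative add.
Proof. by move=> x y z; apply: dsum_ext => j; rewrite /coord/= !scale1r addrA. Qed.
Fact dsum_addC : commutative add.
Proof. by move=> x y; apply: dsum_ext => j; rewrite /coord/= !scale1r addrC. Qed.
Fact dsum_add0 : left_id dsum_zero add.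
Proof. by move=> x; apply: dsum_ext => j; rewrite /coord/= scale1r add0r. Qed.
Fact dsum_addN : left_inverse dsum_zero opp add.
Proof.
by move=> x; apply: dsum_ext => j; rewrite /coord/= scale1r addr0 scaleN1r addNr.
Qed.
HB.instance Definition _ := GRing.isZmodule.Build (dsum V)
  dsum_addA dsum_addC dsum_add0 dsum_addN.

Lemma coord0 j : coord 0 j = 0.
Proof. by []. Qed.
Lemma coordD x y j : coord (x + y) j = coord x j + coord y j.
Proof. by rewrite /coord/= scale1r. Qed.

Fact dsum_scaleA a b x : scale a (scale b x) = scale (a * b) x.
Proof. by apply: dsum_ext => j; rewrite /coord/= !addr0 scalerA. Qed.
Fact dsum_scale1 : left_id 1 scale.
Proof. by move=> x; apply: dsum_ext => j; rewrite /coord/= addr0 scale1r. Qed.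
Fact dsum_scaleDr : right_distributive scale +%R.
Proof.
move=> c x y; apply: dsum_ext => j; rewrite [RHS]coordD.
by rewrite [LHS]coord_lin coordD !coord_lin !addr0 scalerDr.
Qed.
Fact dsum_scaleDl x : {morph scale^~ x : a b / a + b}.
Proof. by move=> a b; apply: dsum_ext => j; rewrite [RHS]coordD !coord_lin !addr0 scalerDl. Qed.
HB.instance Definition _ := GRing.Zmodule_isLmodule.Build K (dsum V)
  dsum_scaleA dsum_scale1 dsum_scaleDr dsum_scaleDl.

Lemma coordZ c x j : coord (c *: x) j = c *: coord x j.
Proof. by rewrite /coord/= addr0. Qed.

End DirectSum.

Arguments coord : simpl never.

Lemma fsum_lin (K : nzRingType) (V : lmodType K) (T : choiceType) (c : K)
    (F G : T -> V) :
  finite_set [set t | F t != 0] -> finite_set [set t | G t != 0] ->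
  \sum_(t \in [set: T]) (c *: F t + G t) =
    c *: (\sum_(t \in [set: T]) F t) + \sum_(t \in [set: T]) G t.
Proof.
set A := [set t | F t != 0]; set B := [set t | G t != 0] => fA fB.
have fAB : finite_set (A `|` B) by rewrite finite_setU.
have E H : (forall t, ~ (A `|` B) t -> H t = 0 :> V) ->
    \sum_(t \in [set: T]) H t = \sum_(t <- fset_set (A `|` B)) H t.
  move=> H0; rewrite -(fsbig_widen (A `|` B) setT) ?fsbig_finite //.
  by move=> t [_ /= /H0].
have F0 t : ~ (A `|` B) t -> F t = 0.
  by move=> nt; apply: contrapT => /eqP Ft; apply: nt; left.
have G0 t : ~ (A `|` B) t -> G t = 0.
  by move=> nt; apply: contrapT => /eqP Gt; apply: nt; right.
rewrite !E //; last by move=> t nt; rewrite F0 // G0 // scaler0 addr0.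
by rewrite big_split /= scaler_sumr.
Qed.

(* A vector space with a bilinear product and a conjugate-linear map. The other
   axioms of *-algebras are left out: they hold for the examples below and are
   not needed to compare the operations along an isomorphism. *)
Record starAlg (K : numClosedFieldType) := StarAlg {
  carrier :> lmodType K;
  amul : carrier -> carrier -> carrier;
  astar : carrier -> carrier;
  amul_linl : forall y, linear (amul^~ y);
  amul_linr : forall x, linear (amul x);
  astar_semilin : forall c x y, astar (c *: x + y) = Num.conj c *: astar x + astar y }.

Definition star_isomorphic K (A B : starAlg K) :=
  exists f : {linear A -> B}, [/\ bijective f,
    {morph f : x y / amul x y >-> amul x y} &
    {morph f : x / astar x >-> astar x}].

Section AnnularAlgebra.
Context {K : numClosedFieldType} {C : cstarTensorCat K}.
Variables (D : irrChoice C) (L : weightSet C).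
Local Notation X := (irr D).
Local Notation Y := (@rep _ _ L).

Definition annularMor (t : L * L * Irr C) : lmodType K :=
  mor (X t.2 ⊗ Y t.1.1) (Y t.1.2 ⊗ X t.2).

(* The component in Mor(X_k ⊗ Y_i, Y_j ⊗ X_k) has coordinate (i, j, k). *)
Definition annular := dsum annularMor.
Implicit Types x y : annular.

Definition annular_mul_term i j k s m l
    (xm : mor (X m ⊗ Y s) (Y j ⊗ X m)) (yl : mor (X l ⊗ Y i) (Y s ⊗ X l)) :
    mor (X k ⊗ Y i) (Y j ⊗ X k) :=
  \sum_(V <- onb D k m l)
    (idm (Y j) ⊠ V^†) ∘ ident (esym (tobA (Y j) (X m) (X l)))
    ∘ (xm ⊠ idm (X l)) ∘ ident (tobA (X m) (Y s) (X l))
    ∘ (idm (X m) ⊠ yl) ∘ ident (esym (tobA (X m) (X l) (Y i)))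
    ∘ (V ⊠ idm (Y i)).

Definition annular_summand x y i j k (q : L * Irr C * Irr C) :
    mor (X k ⊗ Y i) (Y j ⊗ X k) :=
  let: (s, m, l) := q in
  annular_mul_term k (coord x (s, j, m)) (coord y (i, s, l)).

Definition annular_mul_coord x y i j k : mor (X k ⊗ Y i) (Y j ⊗ X k) :=
  \sum_(q \in [set: L * Irr C * Irr C]) annular_summand x y i j k q.

Lemma tobA4 (U V W Z : C) : (U ⊗ V) ⊗ (W ⊗ Z) = (U ⊗ (V ⊗ W)) ⊗ Z.
Proof. by rewrite !tobA. Qed.

Definition annular_star_term i j k
    (xb : mor (X (bar D k) ⊗ Y j) (Y i ⊗ X (bar D k))) :
    mor (X k ⊗ Y i) (Y j ⊗ X k) :=
  ident (tob1l (Y j ⊗ X k)) ∘ ((solb D k)^† ⊠ (idm (Y j) ⊠ idm (X k)))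
  ∘ ident (esym (tobA4 (X k) (X (bar D k)) (Y j) (X k)))
  ∘ ((idm (X k) ⊠ xb^†) ⊠ idm (X k))
  ∘ ident (tobA4 (X k) (Y i) (X (bar D k)) (X k))
  ∘ ((idm (X k) ⊠ idm (Y i)) ⊠ sol D k) ∘ ident (esym (tob1r (X k ⊗ Y i))).

Lemma annular_mul_term_linl i j k s m l c xm xm' (yl : mor (X l ⊗ Y i) (Y s ⊗ X l)) :
  @annular_mul_term i j k s m l (c *: xm + xm') yl =
  c *: annular_mul_term k xm yl + annular_mul_term k xm' yl.
Proof.
rewrite /annular_mul_term scaler_sumr -big_split; apply: eq_bigr => V _ /=.
by rewrite tmorPl !(compPr, compPl).
Qed.

Lemma annular_mul_term_linr i j k s m l c (xm : mor (X m ⊗ Y s) (Y j ⊗ X m)) yl yl' :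
  @annular_mul_term i j k s m l xm (c *: yl + yl') =
  c *: annular_mul_term k xm yl + annular_mul_term k xm yl'.
Proof.
rewrite /annular_mul_term scaler_sumr -big_split; apply: eq_bigr => V _ /=.
by rewrite tmorPr !(compPr, compPl).
Qed.

Lemma annular_star_term_semilin i j k c xb xb' :
  @annular_star_term i j k (c *: xb + xb') =
  Num.conj c *: annular_star_term xb + annular_star_term xb'.
Proof.
by rewrite /annular_star_term adj_semilin tmorPr tmorPl !(compPr, compPl).
Qed.

Lemma annular_summand_neq0 x y i j k s m l :
  annular_summand x y i j k (s, m, l) != 0 ->
  [/\ coord x (s, j, m) != 0, coord y (i, s, l) != 0 & onb D k m l != [::]].
Proof.
move=> nz; split; apply: contraNneq nz; rewrite /= /annular_mul_term.
- by move=> ->; rewrite big1 // => V _; rewrite tmor0m !(compm0, comp0m).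
- by move=> ->; rewrite big1 // => V _; rewrite tmorm0 !(compm0, comp0m).
- by move=> ->; rewrite big_nil.
Qed.

Lemma annular_summand_finite x y i j k :
  finite_set [set q | annular_summand x y i j k q != 0].
Proof.
have := finite_image (fun p : (L * L * Irr C) * (L * L * Irr C) =>
  (p.1.1.1, p.1.2, p.2.2)) (finite_setX (dsumP x) (dsumP y)).
apply: sub_finite_set => -[[s m] l] /annular_summand_neq0 [xs ys _].
by exists ((s, j, m), (i, s, l)).
Qed.

Fact annular_mul_subproof x y : finite_set
  [set t : L * L * Irr C | annular_mul_coord x y t.1.1 t.1.2 t.2 != 0].
Proof.
have : finite_set (\bigcup_(p in [set a | coord x a != 0] `*` [set b | coord y b != 0])
    [set (p.2.1.1, p.1.1.2, k) | k in [set k | onb D k p.1.2 p.2.2 != [::]]]).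
  apply: bigcup_finite => [|p _]; first by apply: finite_setX; exact: dsumP.
  by apply: finite_image; exact: onb_finite.
apply: sub_finite_set => -[[i j] k] /= nz.
have [[[[s m] l] /annular_summand_neq0 [xs ys os]]|nq] :=
  pselect (exists q, annular_summand x y i j k q != 0).
  by exists ((s, j, m), (i, s, l)) => //; exists k.
move: nz; rewrite /annular_mul_coord fsbig1 ?eqxx // => q _.
by apply: contrapT => /eqP nz; apply: nq; exists q.
Qed.

Definition annular_mul x y : annular :=
  exist _ (fun t => annular_mul_coord x y t.1.1 t.1.2 t.2) (annular_mul_subproof x y).

Fact annular_star_subproof x : finite_set
  [set t : L * L * Irr C | annular_star_term (coord x (t.1.2, t.1.1, bar D t.2)) != 0].
Proof.
have := finite_image (fun t : L * L * Irr C => (t.1.2, t.1.1, bar D t.2)) (dsumP x).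
apply: sub_finite_set => -[[i j] k] /= nz; exists (j, i, bar D k); last by rewrite /= barK.
apply: contraNneq nz => /= ->.
have := annular_star_term_semilin (-1) (0 : mor (X (bar D k) ⊗ Y j) (Y i ⊗ X (bar D k))) 0.
by rewrite scaler0 addr0 rmorphN rmorph1 scaleN1r addNr => ->.
Qed.

Definition annular_star x : annular :=
  exist _ (fun t => annular_star_term (coord x (t.1.2, t.1.1, bar D t.2)))
    (annular_star_subproof x).

Lemma coord_annular_mul x y i j k :
  coord (annular_mul x y) (i, j, k) = annular_mul_coord x y i j k.
Proof. by []. Qed.

Lemma coord_annular_star x i j k :
  coord (annular_star x) (i, j, k) = annular_star_term (coord x (j, i, bar D k)).
Proof. by []. Qed.

Fact annular_mul_linl y : linear (annular_mul^~ y).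
Proof.
move=> c x x'; apply: dsum_ext => -[[i j] k]; rewrite coordD coordZ.
rewrite !coord_annular_mul /annular_mul_coord -fsum_lin; try exact: annular_summand_finite.
apply: eq_fsbigr => -[[s m] l] _ /=.
by rewrite coordD coordZ annular_mul_term_linl.
Qed.

Fact annular_mul_linr x : linear (annular_mul x).
Proof.
move=> c y y'; apply: dsum_ext => -[[i j] k]; rewrite coordD coordZ.
rewrite !coord_annular_mul /annular_mul_coord -fsum_lin; try exact: annular_summand_finite.
apply: eq_fsbigr => -[[s m] l] _ /=.
by rewrite coordD coordZ annular_mul_term_linr.
Qed.

Fact annular_star_semilin c x y :
  annular_star (c *: x + y) = Num.conj c *: annular_star x + annular_star y.
Proof.
apply: dsum_ext => -[[i j] k]; rewrite [RHS]coordD coordZ.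
by rewrite !coord_annular_star coordD coordZ annular_star_term_semilin.
Qed.

Definition annularAlg : starAlg K :=
  StarAlg annular_mul_linl annular_mul_linr annular_star_semilin.

End AnnularAlgebra.

Definition tubeAlg (K : numClosedFieldType) (C : cstarTensorCat K)
  (D : irrChoice C) : starAlg K := annularAlg D (irrWeight D).

(* F(I): an operator in the span of the matrix units is identified with its
   matrix in the standard basis, which is finitely supported. *)
Section FiniteMatrices.
Variables (K : numClosedFieldType) (I : choiceType).

Definition finMatrix := dsum (fun _ : I * I => (K^o : lmodType K)).
Implicit Types a b : finMatrix.

Lemma finMatrix_mul_finite a b i j :
  finite_set [set s | (coord a (i, s) * coord b (s, j) : K^o) != 0].
Proof.
have := finite_image snd (dsumP a).
apply: sub_finite_set => s /= nz; exists (i, s) => //=.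
by apply: contraNneq nz => ->; rewrite mul0r.
Qed.

Fact finMatrix_mul_subproof a b : finite_set [set t : I * I |
  (\sum_(s \in [set: I]) (coord a (t.1, s) * coord b (s, t.2)) : K^o) != 0].
Proof.
have := finite_image (fun p : (I * I) * (I * I) => (p.1.1, p.2.2))
  (finite_setX (dsumP a) (dsumP b)).
apply: sub_finite_set => -[i j] /= nz.
have [[s nzs]|ns] := pselect (exists s, (coord a (i, s) * coord b (s, j) : K^o) != 0).
  exists ((i, s), (s, j)) => //=.
  by split; apply: contraNneq nzs => ->; rewrite ?mul0r ?mulr0.
move: nz; rewrite fsbig1 ?eqxx // => s _.
by apply: contrapT => /eqP nz; apply: ns; exists s.
Qed.

Definition finMatrix_mul a b : finMatrix := exist _
  (fun t => \sum_(s \in [set: I]) (coord a (t.1, s) * coord b (s, t.2)) : K^o)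
  (finMatrix_mul_subproof a b).

Fact finMatrix_star_subproof a :
  finite_set [set t : I * I | (Num.conj (coord a (t.2, t.1)) : K^o) != 0].
Proof.
have := finite_image (fun t : I * I => (t.2, t.1)) (dsumP a).
apply: sub_finite_set => -[i j] /= nz; exists (j, i) => //=.
by apply: contraNneq nz => ->; rewrite rmorph0.
Qed.

Definition finMatrix_star a : finMatrix := exist _
  (fun t => Num.conj (coord a (t.2, t.1)) : K^o) (finMatrix_star_subproof a).

Lemma coord_finMatrix_mul a b i j : coord (finMatrix_mul a b) (i, j) =
  \sum_(s \in [set: I]) (coord a (i, s) * coord b (s, j)).
Proof. by []. Qed.

Lemma coord_finMatrix_star a i j :
  coord (finMatrix_star a) (i, j) = Num.conj (coord a (j, i)).
Proof. by []. Qed.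

Fact finMatrix_mul_linl b : linear (finMatrix_mul^~ b).
Proof.
move=> c a a'; apply: dsum_ext => -[i j]; rewrite coordD coordZ.
rewrite !coord_finMatrix_mul -fsum_lin; try exact: finMatrix_mul_finite.
by apply: eq_fsbigr => s _; rewrite coordD coordZ mulrDl scalerAl.
Qed.

Fact finMatrix_mul_linr a : linear (finMatrix_mul a).
Proof.
move=> c b b'; apply: dsum_ext => -[i j]; rewrite coordD coordZ.
rewrite !coord_finMatrix_mul -fsum_lin; try exact: finMatrix_mul_finite.
by apply: eq_fsbigr => s _; rewrite coordD coordZ mulrDr scalerAr.
Qed.

Fact finMatrix_star_semilin c a b :
  finMatrix_star (c *: a + b) = Num.conj c *: finMatrix_star a + finMatrix_star b.
Proof.
apply: dsum_ext => -[i j]; rewrite [RHS]coordD coordZ.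
by rewrite !coord_finMatrix_star coordD coordZ rmorphD rmorphM.
Qed.

Definition finMatrixAlg : starAlg K :=
  StarAlg finMatrix_mul_linl finMatrix_mul_linr finMatrix_star_semilin.

Fact munit_subproof (i j : I) :
  finite_set [set t : I * I | ((t == (i, j))%:R : K^o) != 0].
Proof.
apply: (sub_finite_set _ (finite_set1 (i, j))) => t /=.
by case: (eqVneq t (i, j)) => [->//|_] /negP[]; apply/eqP.
Qed.

Definition munit i j : finMatrixAlg :=
  exist _ (fun t => (t == (i, j))%:R : K^o) (munit_subproof i j).

Lemma coord_munit i j p q : coord (munit i j) (p, q) = ((p == i) && (q == j))%:R.
Proof. by []. Qed.

Lemma amul_munit i j k l :
  amul (munit i j) (munit k l) = (j == k)%:R *: munit i l.
Proof.
apply: dsum_ext => -[p q]; rewrite coordZ coord_finMatrix_mul coord_munit.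
rewrite -(fsbig_widen [set j] setT) //=; last first.
  by move=> s [_ /= /eqP sj]; rewrite coord_munit (negbTE sj) andbF mul0r.
rewrite fsbig_set1 !coord_munit eqxx andbT /GRing.scale /= -!natrM !mulnb.
by case: (p == i); case: (j == k).
Qed.

Lemma astar_munit i j : astar (munit i j) = munit j i.
Proof.
apply: dsum_ext => -[p q]; rewrite coord_finMatrix_star !coord_munit.
by rewrite rmorph_nat andbC.
Qed.

Lemma munit_span (a : finMatrixAlg) :
  exists s : seq (K * (I * I)), a = \sum_(p <- s) p.1 *: munit p.2.1 p.2.2.
Proof.
have [r rE] : exists r : {fset I * I}, [set t | coord a t != 0] = [set` r].
  by apply/finite_fsetP; exact: dsumP.
exists [seq (coord a t, t) | t <- enum_fset r]; rewrite big_map.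
have coord_sum (s : seq (I * I)) F t :
    coord (\sum_(u <- s) F u : finMatrix) t = \sum_(u <- s) coord (F u) t.
  by elim: s => [|u s IH]; rewrite ?big_nil // !big_cons coordD IH.
apply: dsum_ext => -[p q]; rewrite coord_sum.
have Z t : t != (p, q) -> coord (coord a t *: munit t.1 t.2) (p, q) = 0.
  case: t => i j; rewrite coordZ coord_munit -xpair_eqE eq_sym => /negbTE ->.
  by rewrite scaler0.
have [pq|pq] := boolP ((p, q) \in r).
  rewrite (bigD1_seq (p, q)) ?fset_uniq //= big1 ?addr0; last by move=> t /Z.
  by rewrite coordZ coord_munit !eqxx /GRing.scale /= mulr1.
rewrite big1_seq => [|t /andP[_ tr]]; last by apply: Z; apply: contraNneq pq => <-.
apply: contrapT => /eqP nz; case/negP: pq.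
by have : [set` r] (p, q) by rewrite -rE.
Qed.

End FiniteMatrices.

Section TensorProduct.
Context {K : numClosedFieldType} {V W : lmodType K}.

Definition is_bilinear (U : lmodType K) (f : V -> W -> U) :=
  (forall w, linear (f^~ w)) /\ (forall v, linear (f v)).

Definition formal_eval (U : lmodType K) (f : V -> W -> U) (s : seq (V * W)) :=
  \sum_(p <- s) f p.1 p.2.

(* V ⊗ W is the set of formal sums of pairs (v, w), where two sums are equal when
   no bilinear map to a vector space distinguishes them. *)
Definition formal_eq (s t : seq (V * W)) : bool :=
  `[< forall (U : lmodType K) (f : V -> W -> U), is_bilinear f ->
        formal_eval f s = formal_eval f t >].

Fact formal_eq_equiv : equiv_class_of formal_eq.
Proof.
split=> [s|s t|t s u].
- exact/asboolP.
- by apply/asboolP/asboolP => st U f fb; rewrite st.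
- move=> /asboolP st /asboolP tu; apply/asboolP => U f fb.
  by rewrite st // tu.
Qed.
Canonical formal_equiv := EquivRelPack formal_eq_equiv.

Definition tensor := {eq_quot formal_equiv}%qT.
HB.instance Definition _ := Choice.on tensor.
HB.instance Definition _ := EqQuotient.on tensor.
Implicit Types x y z : tensor.

Definition formal_class (s : seq (V * W)) : tensor := (\pi_tensor s)%qT.

Definition pure v w : tensor := formal_class [:: (v, w)].

Definition terms x : seq (V * W) := (repr x)%qT.

(* the linear map V ⊗ W -> U induced by f *)
Definition tensor_lift (U : lmodType K) (f : V -> W -> U) x :=
  formal_eval f (terms x).

Lemma tensor_lift_class (U : lmodType K) (f : V -> W -> U) s :
  is_bilinear f -> tensor_lift f (formal_class s) = formal_eval f s.
Proof.
rewrite /tensor_lift /terms /formal_class; case: piP => t /eqmodP/= /asboolP st fb.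
by rewrite st.
Qed.

Lemma tensor_ext x y :
  (forall (U : lmodType K) (f : V -> W -> U), is_bilinear f ->
    tensor_lift f x = tensor_lift f y) -> x = y.
Proof.
move=> xy; rewrite -(reprK x) -(reprK y); apply/eqmodP/asboolP => U f fb.
exact: xy.
Qed.

Lemma formal_class_terms x : formal_class (terms x) = x.
Proof. exact: reprK. Qed.

Definition formal_scale (c : K) (s : seq (V * W)) := [seq (c *: p.1, p.2) | p <- s].

Lemma formal_eval_scale (U : lmodType K) (f : V -> W -> U) c s :
  is_bilinear f -> formal_eval f (formal_scale c s) = c *: formal_eval f s.
Proof.
move=> [fl _]; have f0 w : f 0 w = 0.
  by have := fl w (-1) 0 0; rewrite /= scaler0 addr0 scaleN1r addNr.
rewrite /formal_eval big_map scaler_sumr; apply: eq_bigr => p _ /=.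
by have := fl p.2 c p.1 0; rewrite /= f0 !addr0.
Qed.

Let zero : tensor := formal_class [::].
Let add x y : tensor := formal_class (terms x ++ terms y).
Let scale c x : tensor := formal_class (formal_scale c (terms x)).
Let opp := scale (-1).

Let lift0 (U : lmodType K) (f : V -> W -> U) :
  is_bilinear f -> tensor_lift f zero = 0.
Proof. by move=> fb; rewrite tensor_lift_class // /formal_eval big_nil. Qed.

Let liftD (U : lmodType K) (f : V -> W -> U) x y :
  is_bilinear f -> tensor_lift f (add x y) = tensor_lift f x + tensor_lift f y.
Proof. by move=> fb; rewrite tensor_lift_class // /formal_eval big_cat. Qed.

Let liftZ (U : lmodType K) (f : V -> W -> U) c x :
  is_bilinear f -> tensor_lift f (scale c x) = c *: tensor_lift f x.
Proof. by move=> fb; rewrite tensor_lift_class // formal_eval_scale. Qed.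

Fact tensor_addA : associative add.
Proof. by move=> x y z; apply: tensor_ext => U f fb; rewrite !liftD // addrA. Qed.
Fact tensor_addC : commutative add.
Proof. by move=> x y; apply: tensor_ext => U f fb; rewrite !liftD // addrC. Qed.
Fact tensor_add0 : left_id zero add.
Proof. by move=> x; apply: tensor_ext => U f fb; rewrite liftD // lift0 // add0r. Qed.
Fact tensor_addN : left_inverse zero opp add.
Proof.
move=> x; apply: tensor_ext => U f fb.
by rewrite liftD // liftZ // lift0 // scaleN1r addNr.
Qed.
HB.instance Definition _ := GRing.isZmodule.Build tensor
  tensor_addA tensor_addC tensor_add0 tensor_addN.

Fact tensor_scaleA a b x : scale a (scale b x) = scale (a * b) x.
Proof. by apply: tensor_ext => U f fb; rewrite !liftZ // scalerA. Qed.
Fact tensor_scale1 : left_id 1 scale.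
Proof. by move=> x; apply: tensor_ext => U f fb; rewrite liftZ // scale1r. Qed.
Fact tensor_scaleDr : right_distributive scale +%R.
Proof.
by move=> c x y; apply: tensor_ext => U f fb; rewrite !(liftZ, liftD) // scalerDr.
Qed.
Fact tensor_scaleDl x : {morph scale^~ x : a b / a + b}.
Proof.
by move=> a b; apply: tensor_ext => U f fb; rewrite !(liftZ, liftD) // scalerDl.
Qed.
HB.instance Definition _ := GRing.Zmodule_isLmodule.Build K tensor
  tensor_scaleA tensor_scale1 tensor_scaleDr tensor_scaleDl.

Lemma tensor_lift_linear (U : lmodType K) (f : V -> W -> U) :
  is_bilinear f -> linear (tensor_lift f).
Proof. by move=> fb c x y; rewrite liftD // liftZ. Qed.

Lemma tensor_lift_pure (U : lmodType K) (f : V -> W -> U) v w :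
  is_bilinear f -> tensor_lift f (pure v w) = f v w.
Proof. by move=> fb; rewrite tensor_lift_class // /formal_eval big_seq1. Qed.

Lemma pure_bilinear : is_bilinear pure.
Proof.
split=> [w c v v'|v c w w']; apply: tensor_ext => U f fb;
  rewrite (tensor_lift_linear fb) !tensor_lift_pure //.
- by case: fb => fl _; exact: fl.
- by case: fb => _ fr; exact: fr.
Qed.

Lemma formal_classE s : formal_class s = \sum_(p <- s) pure p.1 p.2.
Proof.
elim: s => [|p s IH]; first by rewrite big_nil.
rewrite big_cons -IH; apply: tensor_ext => U f fb.
have := tensor_lift_linear fb 1 (pure p.1 p.2) (formal_class s).
rewrite !scale1r => ->; rewrite tensor_lift_pure // !tensor_lift_class //.
by rewrite /formal_eval big_cons.
Qed.

Lemma tensor_span x : x = \sum_(p <- terms x) pure p.1 p.2.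
Proof. by rewrite -formal_classE formal_class_terms. Qed.

End TensorProduct.

Arguments tensor {K} V W.

(* the complex conjugate of a vector space *)
Definition conj_space (K : numClosedFieldType) (U : lmodType K) : Type := U.

Section ConjSpace.
Context {K : numClosedFieldType} {U : lmodType K}.

HB.instance Definition _ := GRing.Zmodule.on (conj_space U).

Let scale (c : K) (u : conj_space U) : conj_space U := Num.conj c *: (u : U).

Fact conj_scaleA a b u : scale a (scale b u) = scale (a * b) u.
Proof. by rewrite /scale scalerA rmorphM. Qed.
Fact conj_scale1 : left_id 1 scale.
Proof. by move=> u; rewrite /scale rmorph1 scale1r. Qed.
Fact conj_scaleDr : right_distributive scale +%R.
Proof. by move=> c u v; exact: scalerDr. Qed.
Fact conj_scaleDl u : {morph scale^~ u : a b / a + b}.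
Proof. by move=> a b; rewrite /scale rmorphD scalerDl. Qed.
HB.instance Definition _ := GRing.Zmodule_isLmodule.Build K (conj_space U)
  conj_scaleA conj_scale1 conj_scaleDr conj_scaleDl.

End ConjSpace.

Section TensorAlgebra.
Context {K : numClosedFieldType}.
Variables A B : starAlg K.
Implicit Types x y z : tensor A B.

Definition tensor_mul x y : tensor A B :=
  \sum_(p <- terms x) \sum_(q <- terms y)
    pure (amul p.1 q.1) (amul p.2 q.2).

Definition tensor_star x : tensor A B :=
  \sum_(p <- terms x) pure (astar p.1) (astar p.2).

Fact tensor_mul_linl y : linear (tensor_mul^~ y).
Proof.
pose f (a : A) (a' : B) := \sum_(q <- terms y) pure (amul a q.1) (amul a' q.2).
suff fb : is_bilinear f by move=> c x x'; exact: (tensor_lift_linear fb).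
have [pl pr] := @pure_bilinear _ A B.
split=> [a' c a b|a c a' b'] /=; rewrite /f scaler_sumr -big_split; apply: eq_bigr => q _ /=.
- by rewrite amul_linl pl.
- by rewrite amul_linl pr.
Qed.

Lemma tensor_mulE x y : tensor_mul x y =
  \sum_(q <- terms y) \sum_(p <- terms x)
    pure (amul p.1 q.1) (amul p.2 q.2).
Proof. by rewrite /tensor_mul exchange_big. Qed.

Fact tensor_mul_linr x : linear (tensor_mul x).
Proof.
pose f (a : A) (a' : B) := \sum_(p <- terms x) pure (amul p.1 a) (amul p.2 a').
suff fb : is_bilinear f.
  by move=> c y y'; rewrite !tensor_mulE; exact: (tensor_lift_linear fb).
have [pl pr] := @pure_bilinear _ A B.
split=> [a' c a b|a c a' b'] /=; rewrite /f scaler_sumr -big_split; apply: eq_bigr => q _ /=.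
- by rewrite amul_linr pl.
- by rewrite amul_linr pr.
Qed.

Let star_fun (a : A) (b : B) : conj_space (tensor A B) := pure (astar a) (astar b).

Let star_fun_bilinear : is_bilinear star_fun.
Proof.
have [pl pr] := @pure_bilinear _ A B.
split=> [b c a a'|a c b b'] /=; rewrite /star_fun astar_semilin.
- by rewrite pl.
- by rewrite pr.
Qed.

Fact tensor_star_semilin c x y :
  tensor_star (c *: x + y) = Num.conj c *: tensor_star x + tensor_star y.
Proof. exact: (tensor_lift_linear star_fun_bilinear). Qed.

Definition tensorAlg : starAlg K :=
  StarAlg tensor_mul_linl tensor_mul_linr tensor_star_semilin.

Lemma amul_pure a a' b b' :
  amul (pure a b : tensorAlg) (pure a' b') = pure (amul a a') (amul b b').
Proof.
have [pl pr] := @pure_bilinear _ A B.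
pose g c d (e : A) (f : B) := pure (amul e c) (amul f d).
have gb c d : is_bilinear (g c d).
  split=> [w k v v'|v k w w'] /=; rewrite /g amul_linl.
  - by rewrite pl.
  - by rewrite pr.
rewrite /= tensor_mulE.
transitivity (\sum_(q <- terms (pure a' b')) pure (amul a q.1) (amul b q.2)).
  by apply: eq_bigr => q _; exact: (tensor_lift_pure a b (gb q.1 q.2)).
pose h (e : A) (f : B) := pure (amul a e) (amul b f).
have hb : is_bilinear h.
  split=> [w k v v'|v k w w'] /=; rewrite /h amul_linr.
  - by rewrite pl.
  - by rewrite pr.
exact: (tensor_lift_pure a' b' hb).
Qed.

Lemma astar_pure a b : astar (pure a b : tensorAlg) = pure (astar a) (astar b).
Proof. exact: (tensor_lift_pure a b star_fun_bilinear). Qed.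

End TensorAlgebra.

(* Main.v *)
Require Import Defs.
From HB Require Import structures.
From mathcomp Require Import all_boot all_order all_algebra finmap spectral.
From mathcomp Require Import boolp classical_sets functions cardinality fsbigop reals.
From mathcomp Require Import complex.
Import Defs.

Set Implicit Arguments.
Unset Strict Implicit.
Unset Printing Implicit Defensive.

Import Order.TTheory GRing.Theory Num.Theory.
Local Open Scope classical_set_scope.
Local Open Scope ring_scope.

(* Let Y : J -> C be a family of objects and A(Y) the direct sum of the spaces
   Mor(X_k ⊗ Y_t, Y_s ⊗ X_k), with the annular product and involution. Then
   F(I) ⊗ AΛ is A(Y) for the family Y over I × Λ that repeats every weight I times,
   and F(I) ⊗ A is A(Y) for the family over I × Irr(C) that repeats every simple
   object I times. Conjugation by a unitary matrix of morphisms W(t, w) : Y_t -> Y'_w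
   with finitely supported rows and columns is a *-isomorphism A(Y) ≅ A(Y').
   Such a matrix exists between these two families. In the decompositions of the
   weights into simple objects, repeated I times, each simple object occurs at least
   once per element of I by fullness, and countably often because the weights are
   determined by their multiplicities; so its occurrences are in bijection with I. *)

(** * Linear maps and sums over lists without repetition *)

Section Linear.
Context {K : nzRingType} {U V : lmodType K} {f : U -> V}.
Hypothesis fl : linear f.

Definition linear_of : {linear U -> V} :=
  HB.pack f (GRing.isLinear.Build K U V *:%R f fl).

Lemma linear_map0 : f 0 = 0.
Proof. exact: (raddf0 linear_of). Qed.

Lemma linear_map_sum (T : Type) (r : seq T) (P : pred T) (F : T -> U) :
  f (\sum_(i <- r | P i) F i) = \sum_(i <- r | P i) f (F i).
Proof. exact: (raddf_sum linear_of). Qed.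

End Linear.

Lemma big_uniq_widen (V : nmodType) (T : eqType) (r Q : seq T) (F : T -> V) :
  uniq r -> uniq Q -> {subset r <= Q} -> (forall t, t \notin r -> F t = 0) ->
  \sum_(t <- r) F t = \sum_(t <- Q) F t.
Proof.
move=> ur uQ rQ F0; rewrite [RHS](bigID (mem r)) /= addrC [X in _ = X + _]big1 ?add0r //.
rewrite -[RHS]big_filter; apply: perm_big; apply: uniq_perm; rewrite ?filter_uniq //.
by move=> t; rewrite mem_filter; case: (boolP (t \in r)) => //= /rQ ->.
Qed.

(** The lists in question are supports, which may omit an index where the term is zero; hence the
    last hypothesis in place of membership of [a]. *)
Lemma big_uniq_single (V : nmodType) (T : eqType) (r : seq T) (a : T) (F : T -> V) :
  uniq r -> (forall t, t != a -> F t = 0) -> (a \notin r -> F a = 0) ->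
  \sum_(t <- r) F t = F a.
Proof.
move=> ur F0 Fa; have [ar|/Fa Fa0] := boolP (a \in r).
  by rewrite (bigD1_seq a) //= big1 ?addr0.
by rewrite Fa0 big1 // => t _; have [->|/F0] := eqVneq t a.
Qed.

(** * Naturality of the annular product and involution *)

Section Naturality.
Context {K : numClosedFieldType} {C : cstarTensorCat K}.
Implicit Types X Y Z W : C.

Lemma identK X Y (e : X = Y) : ident (esym e) ∘ ident e = idm X.
Proof. by case: _ / e; rewrite /= comp1m. Qed.

Lemma identVK X Y (e : X = Y) : ident e ∘ ident (esym e) = idm Y.
Proof. by case: _ / e; rewrite /= comp1m. Qed.

Lemma ident_comp X Y Z (e : X = Y) (e' : Y = Z) :
  ident e' ∘ ident e = ident (etrans e e').
Proof. by case: _ / e'; rewrite comp1m. Qed.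

Lemma ident_tmorl X Y Z (e : X = Y) (e' : X ⊗ Z = Y ⊗ Z) :
  ident e' = ident e ⊠ idm Z.
Proof. by case: _ / e e' => e'; rewrite (Prop_irrelevance e' erefl) tmor1. Qed.

Lemma ident_esym X X' Y Y' (e : X = Y) (e' : X' = Y') (f : mor X X') (g : mor Y Y') :
  ident e' ∘ f = g ∘ ident e -> ident (esym e') ∘ g = f ∘ ident (esym e).
Proof.
move=> fg; rewrite -[g in LHS]compm1 -(identVK e) (compA g) -fg.
by rewrite !compA identK comp1m.
Qed.

Lemma tmorAV X X' Y Y' Z Z' (f : mor X X') (g : mor Y Y') (h : mor Z Z') :
  ident (esym (tobA X' Y' Z')) ∘ ((f ⊠ g) ⊠ h)
    = (f ⊠ (g ⊠ h)) ∘ ident (esym (tobA X Y Z)).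
Proof. by apply: ident_esym; rewrite tmorA. Qed.

Lemma tmorA4 X X' Y Y' Z Z' W W'
    (f : mor X X') (g : mor Y Y') (h : mor Z Z') (k : mor W W') :
  ident (tobA4 X' Y' Z' W') ∘ ((f ⊠ g) ⊠ (h ⊠ k))
    = ((f ⊠ (g ⊠ h)) ⊠ k) ∘ ident (tobA4 X Y Z W).
Proof.
(* The four-fold identification is a composite of two three-fold ones, so its naturality follows
   from [tmorA] and [tmorAV]. *)
have E (U1 U2 U3 U4 : C) : ident (tobA4 U1 U2 U3 U4) =
    (ident (esym (tobA U1 U2 U3)) ⊠ idm U4) ∘ ident (tobA (U1 ⊗ U2) U3 U4).
  have e' : (U1 ⊗ U2 ⊗ U3) ⊗ U4 = (U1 ⊗ (U2 ⊗ U3)) ⊗ U4 by rewrite tobA.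
  by rewrite -(ident_tmorl _ e') ident_comp; congr ident; exact: Prop_irrelevance.
rewrite !E -!compA tmorA !compA -!tmor_comp.
by rewrite tmorAV (comp1m k) (compm1 k).
Qed.

Lemma tmorA4V X X' Y Y' Z Z' W W'
    (f : mor X X') (g : mor Y Y') (h : mor Z Z') (k : mor W W') :
  ident (esym (tobA4 X' Y' Z' W')) ∘ ((f ⊠ (g ⊠ h)) ⊠ k)
    = ((f ⊠ g) ⊠ (h ⊠ k)) ∘ ident (esym (tobA4 X Y Z W)).
Proof. by apply: ident_esym; rewrite tmorA4. Qed.

Lemma tmor1rV X X' (f : mor X X') :
  ident (esym (tob1r X')) ∘ f = (f ⊠ idm (tunit C)) ∘ ident (esym (tob1r X)).
Proof. by apply: ident_esym; rewrite tmor1r. Qed.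

Lemma tmor_swap X X' Y Y' (f : mor X X') (g : mor Y Y') :
  (f ⊠ idm Y') ∘ (idm X ⊠ g) = (idm X' ⊠ g) ∘ (f ⊠ idm Y).
Proof. by rewrite -!tmor_comp !comp1m !compm1. Qed.

Lemma adj_idm X : (idm X)^† = idm X.
Proof. by rewrite -[LHS]comp1m -{1}(adjK (idm X)) -adj_comp comp1m adjK. Qed.

(* With the adjoint of [a], [act] is covariant in both [a] and [b], but
   conjugate-linear in [a]. *)
Definition act (U : C) A A' B B' (a : mor A A') (b : mor B B')
    (x : mor (U ⊗ A) (B ⊗ U)) : mor (U ⊗ A') (B' ⊗ U) :=
  (b ⊠ idm U) ∘ x ∘ (idm U ⊠ a^†).

Lemma act_comp U A A' A'' B B' B'' (a : mor A A') (a' : mor A' A'')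
    (b : mor B B') (b' : mor B' B'') (x : mor (U ⊗ A) (B ⊗ U)) :
  act a' b' (act a b x) = act (a' ∘ a) (b' ∘ b) x.
Proof.
by rewrite /act adj_comp !compA -tmor_comp comp1m -!compA -tmor_comp comp1m.
Qed.

Lemma act1 U A B (x : mor (U ⊗ A) (B ⊗ U)) : act (idm A) (idm B) x = x.
Proof. by rewrite /act adj_idm !tmor1 comp1m compm1. Qed.

Lemma act_linear U A A' B B' (a : mor A A') (b : mor B B') : linear (@act U A A' B B' a b).
Proof. by move=> c x y; rewrite /act compPr compPl. Qed.

Lemma compDl X Y Z (f f' : mor Y Z) (g : mor X Y) : (f + f') ∘ g = f ∘ g + f' ∘ g.
Proof. by have := compPl 1 f f' g; rewrite !scale1r. Qed.

Lemma compDr X Y Z (f : mor Y Z) (g g' : mor X Y) : f ∘ (g + g') = f ∘ g + f ∘ g'.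
Proof. by have := compPr 1 f g g'; rewrite !scale1r. Qed.

Lemma comp_suml X Y Z (T : Type) (r : seq T) (P : pred T) (F : T -> mor Y Z) (g : mor X Y) :
  (\sum_(t <- r | P t) F t) ∘ g = \sum_(t <- r | P t) (F t ∘ g).
Proof. exact: (linear_map_sum (comp_linl g)). Qed.

Lemma comp_sumr X Y Z (T : Type) (r : seq T) (P : pred T) (F : T -> mor X Y) (g : mor Y Z) :
  g ∘ (\sum_(t <- r | P t) F t) = \sum_(t <- r | P t) (g ∘ F t).
Proof. exact: (linear_map_sum (comp_linr g)). Qed.

Lemma adj_add X Y (f g : mor X Y) : (f + g)^† = f^† + g^†.
Proof. by have := adj_semilin 1 f g; rewrite rmorph1 !scale1r. Qed.

Lemma adj_sum X Y (T : Type) (r : seq T) (P : pred T) (F : T -> mor X Y) :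
  (\sum_(t <- r | P t) F t)^† = \sum_(t <- r | P t) (F t)^†.
Proof. by apply: (big_morph _ (@adj_add X Y)); exact: adj0. Qed.

Lemma act_suml U A A' B B' (T : Type) (r : seq T) (F : T -> mor A A') (b : mor B B')
    (x : mor (U ⊗ A) (B ⊗ U)) :
  act (\sum_(t <- r) F t) b x = \sum_(t <- r) act (F t) b x.
Proof.
rewrite /act adj_sum (linear_map_sum (tmor_linr _)) comp_sumr.
by [].
Qed.

Lemma act_sumr U A A' B B' (T : Type) (r : seq T) (a : mor A A') (F : T -> mor B B')
    (x : mor (U ⊗ A) (B ⊗ U)) :
  act a (\sum_(t <- r) F t) x = \sum_(t <- r) act a (F t) x.
Proof. by rewrite /act (linear_map_sum (tmor_linl _)) !comp_suml. Qed.

Lemma act0r U A A' B B' (a : mor A A') (x : mor (U ⊗ A) (B ⊗ U)) :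
  act a (0 : mor B B') x = 0.
Proof. by rewrite /act tmor0m !comp0m. Qed.

Variable D : irrChoice C.
Local Notation X := (irr D).

(* [mul_term] and [star_term] are [annular_mul_term] and [annular_star_term] with
   arbitrary objects in place of weights. *)
Definition mul_term (A S B : C) k m l
    (x : mor (X m ⊗ S) (B ⊗ X m)) (y : mor (X l ⊗ A) (S ⊗ X l)) :
    mor (X k ⊗ A) (B ⊗ X k) :=
  \sum_(V <- onb D k m l)
    (idm B ⊠ V^†) ∘ ident (esym (tobA B (X m) (X l)))
    ∘ (x ⊠ idm (X l)) ∘ ident (tobA (X m) S (X l))
    ∘ (idm (X m) ⊠ y) ∘ ident (esym (tobA (X m) (X l) A))
    ∘ (V ⊠ idm A).

Definition star_term (A B : C) k
    (x : mor (X (bar D k) ⊗ B) (A ⊗ X (bar D k))) : mor (X k ⊗ A) (B ⊗ X k) :=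
  ident (tob1l (B ⊗ X k)) ∘ ((solb D k)^† ⊠ (idm B ⊠ idm (X k)))
  ∘ ident (esym (tobA4 (X k) (X (bar D k)) B (X k)))
  ∘ ((idm (X k) ⊠ x^†) ⊠ idm (X k))
  ∘ ident (tobA4 (X k) A (X (bar D k)) (X k))
  ∘ ((idm (X k) ⊠ idm A) ⊠ sol D k) ∘ ident (esym (tob1r (X k ⊗ A))).

(** [a] and [b] act on the outer legs, so they slide past the associators and [V]; on the middle leg
    the two actions meet as [s1^† ∘ s2]. When these are matrix entries, summing over the middle
    object gives an entry of [W^† W]. *)
Lemma mul_term_act A A' S S1 S2 B B' k m l (a : mor A A') (s1 : mor S1 S) (s2 : mor S2 S)
    (b : mor B B') (x : mor (X m ⊗ S1) (B ⊗ X m)) (y : mor (X l ⊗ A) (S2 ⊗ X l)) :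
  mul_term k (act s1 b x) (act a s2 y) =
  act a b (mul_term k x (act (idm A) (s1^† ∘ s2) y)).
Proof.
rewrite /mul_term (linear_map_sum (act_linear _ _)); apply: eq_bigr => V _.
rewrite /act adj_idm tmor1 compm1.
have -> : ((b ⊠ idm (X m)) ∘ x ∘ (idm (X m) ⊠ s1^†)) ⊠ idm (X l) =
   ((b ⊠ idm (X m)) ⊠ idm (X l)) ∘ (x ⊠ idm (X l)) ∘ ((idm (X m) ⊠ s1^†) ⊠ idm (X l)).
  by rewrite -!tmor_comp !comp1m.
have -> : idm (X m) ⊠ ((s2 ⊠ idm (X l)) ∘ y ∘ (idm (X l) ⊠ a^†)) =
   (idm (X m) ⊠ (s2 ⊠ idm (X l))) ∘ (idm (X m) ⊠ y) ∘ (idm (X m) ⊠ (idm (X l) ⊠ a^†)).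
  by rewrite -!tmor_comp !comp1m.
have -> : idm (X m) ⊠ ((s1^† ∘ s2) ⊠ idm (X l) ∘ y) =
   (idm (X m) ⊠ (s1^† ⊠ idm (X l))) ∘ (idm (X m) ⊠ (s2 ⊠ idm (X l))) ∘ (idm (X m) ⊠ y).
  by rewrite -!tmor_comp !comp1m.
rewrite !compA.
have -> : (idm B' ⊠ V^†) ∘ ident (esym (tobA B' (X m) (X l))) ∘ ((b ⊠ idm (X m)) ⊠ idm (X l))
   = (b ⊠ idm (X k)) ∘ (idm B ⊠ V^†) ∘ ident (esym (tobA B (X m) (X l))).
  rewrite -compA tmorAV tmor1 !compA; congr (_ ∘ _).
  by rewrite -!tmor_comp !comp1m !compm1.
rewrite -!compA (compA (idm (X m) ⊠ (idm (X l) ⊠ a^†))) -tmorAV tmor1.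
rewrite -(compA (ident _)) -tmor_swap.
by rewrite (compA (ident (tobA (X m) S1 (X l)))) tmorA -!compA.
Qed.

(** The involution takes the adjoint and bends the [X_k] strands with [sol] and [solb], which swaps
    the two weight legs; each entry then moves outside by naturality. *)
Lemma star_term_act A A' B B' k (a : mor A A') (b : mor B B')
    (x : mor (X (bar D k) ⊗ B) (A ⊗ X (bar D k))) :
  star_term (act b a x) = act a b (star_term x).
Proof.
rewrite /act /star_term !adj_comp !tmor_adj adjK adj_idm.
have -> : (idm (X k) ⊠ ((idm (X (bar D k)) ⊠ b) ∘ (x^† ∘ (a^† ⊠ idm (X (bar D k))))))
            ⊠ idm (X k) =
   ((idm (X k) ⊠ (idm (X (bar D k)) ⊠ b)) ⊠ idm (X k)) ∘ ((idm (X k) ⊠ x^†) ⊠ idm (X k))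
   ∘ ((idm (X k) ⊠ (a^† ⊠ idm (X (bar D k)))) ⊠ idm (X k)).
  by rewrite -!tmor_comp !comp1m -!compA.
have L : ident (tob1l (B' ⊗ X k)) ∘ ((solb D k)^† ⊠ (idm B' ⊠ idm (X k)))
    ∘ ident (esym (tobA4 (X k) (X (bar D k)) B' (X k)))
    ∘ ((idm (X k) ⊠ (idm (X (bar D k)) ⊠ b)) ⊠ idm (X k))
  = (b ⊠ idm (X k)) ∘ (ident (tob1l (B ⊗ X k)) ∘ ((solb D k)^† ⊠ (idm B ⊠ idm (X k)))
    ∘ ident (esym (tobA4 (X k) (X (bar D k)) B (X k)))).
  rewrite -compA tmorA4V !compA; congr (_ ∘ _); rewrite -tmor1l -!compA; congr (_ ∘ _).
  by rewrite -!tmor_comp !(comp1m, compm1) tmor1 compm1.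
have R : ((idm (X k) ⊠ (a^† ⊠ idm (X (bar D k)))) ⊠ idm (X k))
    ∘ ident (tobA4 (X k) A' (X (bar D k)) (X k))
    ∘ ((idm (X k) ⊠ idm A') ⊠ sol D k) ∘ ident (esym (tob1r (X k ⊗ A')))
  = ident (tobA4 (X k) A (X (bar D k)) (X k))
    ∘ ((idm (X k) ⊠ idm A) ⊠ sol D k) ∘ ident (esym (tob1r (X k ⊗ A)))
    ∘ (idm (X k) ⊠ a^†).
  rewrite -tmorA4 -!compA; congr (_ ∘ _); rewrite tmor1rV !compA; congr (_ ∘ _).
  by rewrite -!tmor_comp !(comp1m, compm1) tmor1 comp1m.
by rewrite !compA L -!compA; rewrite -!compA in R; rewrite R.
Qed.

End Naturality.

(** * Finite sums in *-algebras *)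

Section StarAlgebras.
Context {K : numClosedFieldType}.

Lemma amul_suml (B : starAlg K) (T : Type) (r : seq T) (F : T -> B) (b : B) :
  amul (\sum_(t <- r) F t) b = \sum_(t <- r) amul (F t) b.
Proof. exact: (linear_map_sum (amul_linl b)). Qed.

Lemma amul_sumr (B : starAlg K) (T : Type) (r : seq T) (F : T -> B) (b : B) :
  amul b (\sum_(t <- r) F t) = \sum_(t <- r) amul b (F t).
Proof. exact: (linear_map_sum (amul_linr b)). Qed.

Lemma amulDl (B : starAlg K) (a b c : B) : amul (a + b) c = amul a c + amul b c.
Proof. by have := amul_linl c 1 a b; rewrite !scale1r. Qed.

Lemma amulDr (B : starAlg K) (a b c : B) : amul c (a + b) = amul c a + amul c b.
Proof. by have := amul_linr c 1 a b; rewrite !scale1r. Qed.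

Lemma astar_add (B : starAlg K) (a b : B) : astar (a + b) = astar a + astar b.
Proof. by have := astar_semilin 1 a b; rewrite rmorph1 !scale1r. Qed.

Lemma astar_0 (B : starAlg K) : astar 0 = 0 :> B.
Proof.
have := astar_semilin (-1) (0 : B) 0.
by rewrite scaler0 addr0 rmorphN rmorph1 scaleN1r addNr.
Qed.

Lemma astar_sum (B : starAlg K) (T : Type) (r : seq T) (F : T -> B) :
  astar (\sum_(t <- r) F t) = \sum_(t <- r) astar (F t).
Proof. by apply: (big_morph _ (@astar_add B)); exact: astar_0. Qed.

End StarAlgebras.

(** * Annular algebras of families of objects, and conjugation by matrices of morphisms *)

Section Presentations.
Context {K : numClosedFieldType} {C : cstarTensorCat K} (D : irrChoice C).
Local Notation X := (irr D).

Lemma mul_term_linr A S B k m l (x : mor (X m ⊗ S) (B ⊗ X m)) :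
  linear (@mul_term _ _ D A S B k m l x).
Proof.
move=> c y y'; rewrite /mul_term scaler_sumr -big_split; apply: eq_bigr => V _ /=.
by rewrite tmorPr !(compPr, compPl).
Qed.

(** Only simple objects contained in [X_m ⊗ X_l] contribute to a product of components [m] and [l];
    the list makes that sum over [k] finite. *)
Definition constituents (m l : Irr C) : seq (Irr C) :=
  enum_fset (fset_set [set k | onb D k m l != [::]]).

Lemma mul_term_out A S B k m l x y : k \notin constituents m l ->
  @mul_term _ _ D A S B k m l x y = 0.
Proof.
rewrite /constituents in_fset_set ?inE /=; last exact: onb_finite.
by move=> /asboolPn/negP; rewrite negbK => /eqP V0; rewrite /mul_term V0 big_nil.
Qed.

(* [presents gen] says that [A] is the annular *-algebra A(Y) of the family [Y],
   where [gen s t k] is the inclusion of the summand Mor(X_k ⊗ Y_t, Y_s ⊗ X_k). *)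
Record presents (J : eqType) (Y : J -> C) (A : starAlg K)
    (gen : forall s t k, mor (X k ⊗ Y t) (Y s ⊗ X k) -> A) : Prop := Presents {
  gen_lin : forall s t k, linear (gen s t k);
  gen_ind : forall P : A -> Prop, P 0 -> (forall a b, P a -> P b -> P (a + b)) ->
    (forall s t k x, P (gen s t k x)) -> forall a, P a;
  gen_lift : forall (U : lmodType K)
    (phi : forall s t k, mor (X k ⊗ Y t) (Y s ⊗ X k) -> U),
    (forall s t k, linear (phi s t k)) ->
    exists h : {linear A -> U}, forall s t k x, h (gen s t k x) = phi s t k x;
  gen_mul : forall s t u m l x y, amul (gen s t m x) (gen t u l y) =
    \sum_(k <- constituents m l) gen s u k (mul_term k x y);
  gen_mul0 : forall s t t' u m l x y, t != t' -> amul (gen s t m x) (gen t' u l y) = 0;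
  gen_star : forall s t k x, astar (gen s t (bar D k) x) = gen t s k (star_term x) }.

Arguments gen_lin {J Y A gen} p s t k c x y : rename.

(** A morphism between formal direct sums, given by its entries. [row_supp] need only contain the
    support of a row; finiteness of the columns comes from a second matrix that holds the
    adjoints. *)
Record morMatrix (J J' : eqType) (Y : J -> C) (Y' : J' -> C) := MorMatrix {
  entry :> forall t w, mor (Y t) (Y' w);
  row_supp : J -> seq J';
  row_supp_uniq : forall t, uniq (row_supp t);
  entry_out : forall t w, w \notin row_supp t -> entry t w = 0 }.

(** The diagonal and off-diagonal entries of [W^† W = 1]; terms with [w] outside row [t] vanish. *)
Definition isometric (J J' : eqType) (Y : J -> C) (Y' : J' -> C) (W : morMatrix Y Y') :=
  (forall t, \sum_(w <- row_supp W t) (W t w)^† ∘ W t w = idm (Y t)) /\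
  (forall s t, s != t -> \sum_(w <- row_supp W t) (W t w)^† ∘ W s w = 0).

Section Transport.
Context {J J' : eqType} {Y : J -> C} {Y' : J' -> C} {A A' : starAlg K}.
Context {gen : forall s t k, mor (X k ⊗ Y t) (Y s ⊗ X k) -> A}.
Context {gen' : forall s t k, mor (X k ⊗ Y' t) (Y' s ⊗ X k) -> A'}.
Hypotheses (pA : presents gen) (pA' : presents gen').
Variable W : morMatrix Y Y'.

(** The components of [W x W^†] for [x] in one summand. *)
Definition conj_gen s t k x : A' :=
  \sum_(w <- row_supp W t) \sum_(w' <- row_supp W s) @gen' w' w k (act (W t w) (W s w') x).

Lemma conj_gen_lin s t k : linear (@conj_gen s t k).
Proof.
move=> c x x'; rewrite /conj_gen scaler_sumr -big_split; apply: eq_bigr => w _ /=.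
rewrite scaler_sumr -big_split; apply: eq_bigr => w' _ /=.
by rewrite act_linear (gen_lin pA').
Qed.

(** In [(W x W^†) (W y W^†)] the inner factor [W^† W] enters through its entry from [t'] to [t]. *)
Lemma conj_gen_mul s t t' u m l x y :
  amul (@conj_gen s t m x) (@conj_gen t' u l y) =
  \sum_(k <- constituents m l)
    @conj_gen s u k (mul_term k x (act (idm (Y u))
      (\sum_(w <- row_supp W t) (W t w)^† ∘ W t' w) y)).
Proof.
under [RHS]eq_bigr => k _.
  rewrite act_sumr (linear_map_sum (mul_term_linr _ _)).
  rewrite (linear_map_sum (@conj_gen_lin s u k)).
  over.
rewrite exchange_big /conj_gen amul_suml; apply: eq_bigr => w _ /=.
under [RHS]eq_bigr => k _ do rewrite exchange_big.
rewrite [RHS]exchange_big amul_suml; apply: eq_bigr => w' _ /=.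
rewrite [RHS]exchange_big amul_sumr; apply: eq_bigr => z _ /=.
(* Middle indices must agree, so only [z' = w] survives; if [w] is outside row [t'], the entry there
   is zero anyway. *)
rewrite amul_sumr (big_uniq_single (a := w)) ?row_supp_uniq //.
- by rewrite (gen_mul pA'); apply: eq_bigr => k _; rewrite mul_term_act.
- by move=> z' z'w; rewrite (gen_mul0 pA') // eq_sym.
- move=> /entry_out ->; rewrite act0r (linear_map0 (gen_lin pA' _ _ _)).
  exact: (linear_map0 (amul_linr _)).
Qed.

Lemma conj_gen_star s t k x :
  astar (@conj_gen s t (bar D k) x) = @conj_gen t s k (star_term x).
Proof.
rewrite /conj_gen astar_sum exchange_big; apply: eq_bigr => w _ /=.
rewrite astar_sum; apply: eq_bigr => w' _.
by rewrite (gen_star pA') star_term_act.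
Qed.

Lemma conj_mul (f : {linear A -> A'}) :
  (forall s t k x, f (@gen s t k x) = @conj_gen s t k x) -> isometric W ->
  {morph f : a b / amul a b >-> amul a b}.
Proof.
move=> fE [W1 W0] a b; elim/(gen_ind pA): a => [|a a' IH IH'|s t m x].
- by rewrite linear0 !(linear_map0 (amul_linl _)) linear0.
- by rewrite !(linearD, amulDl) IH IH'.
elim/(gen_ind pA): b => [|b b' IH IH'|t' u l y].
- by rewrite linear0 !(linear_map0 (amul_linr _)) linear0.
- by rewrite !(linearD, amulDr) IH IH'.
rewrite !fE conj_gen_mul; have [tt'|tt'] := eqVneq t t'.
  subst t'; rewrite (gen_mul pA) linear_sum W1 act1.
  by apply: eq_bigr => k _; rewrite fE.
rewrite (gen_mul0 pA) // W0 1?eq_sym // linear0 big1 // => k _.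
by rewrite act0r (linear_map0 (mul_term_linr _ _)) (linear_map0 (@conj_gen_lin _ _ _)).
Qed.

Lemma conj_star (f : {linear A -> A'}) :
  (forall s t k x, f (@gen s t k x) = @conj_gen s t k x) ->
  {morph f : a / astar a >-> astar a}.
Proof.
move=> fE a; elim/(gen_ind pA): a => [|a a' IH IH'|s t k].
- by rewrite astar_0 linear0 astar_0.
- by rewrite astar_add !linearD astar_add IH IH'.
(* As [bar] is an involution, every component has an index of the form [bar k], where [gen_star]
   applies. *)
by rewrite -(barK D k) => x; rewrite (gen_star pA) !fE conj_gen_star.
Qed.

End Transport.

Arguments conj_gen {J J' Y Y' A'} gen' W s t k x.
Arguments conj_gen_lin {J J' Y Y' A' gen'} pA' W s t k.

(** The relation [W^† W = 1] seen through additive maps [Phi]; [conj_cancel] uses it once on each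
    leg. *)
Lemma isometric_collapse (J J' : eqType) (Y : J -> C) (Y' : J' -> C)
    (W : morMatrix Y Y') (V : morMatrix Y' Y) (B : zmodType) (t : J)
    (Phi : forall t', mor (Y t) (Y t') -> B) :
  (forall t' (r : seq J') F, Phi t' (\sum_(w <- r) F w) = \sum_(w <- r) Phi t' (F w)) ->
  (forall t w, V w t = (W t w)^†) -> isometric W ->
  \sum_(w <- row_supp W t) \sum_(t' <- row_supp V w) Phi t' (V w t' ∘ W t w)
    = Phi t (idm (Y t)).
Proof.
move=> PhiD VW [W1 W0]; have Phi0 t' : Phi t' 0 = 0.
  by have := PhiD t' [::] (fun=> 0); rewrite !big_nil.
(* The inner range depends on [w]; a common list [Q] lets the two sums be exchanged. *)
pose Q := undup (flatten [seq row_supp V w | w <- row_supp W t]).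
have QP w : w \in row_supp W t -> \sum_(t' <- row_supp V w) Phi t' (V w t' ∘ W t w) =
    \sum_(t' <- Q) Phi t' (V w t' ∘ W t w).
  move=> wt; apply: big_uniq_widen; rewrite ?row_supp_uniq ?undup_uniq //.
  - move=> t' t'w; rewrite mem_undup; apply/flattenP; exists (row_supp V w) => //.
    exact: map_f.
  - by move=> t' /entry_out ->; rewrite comp0m Phi0.
rewrite (eq_big_seq _ QP) exchange_big.
have PhiE t' : \sum_(w <- row_supp W t) Phi t' (V w t' ∘ W t w) =
    Phi t' (\sum_(w <- row_supp W t) V w t' ∘ W t w) by rewrite PhiD.
under eq_bigr => t' _ do rewrite PhiE.
have VWE t' : \sum_(w <- row_supp W t) V w t' ∘ W t w =
    (\sum_(w <- row_supp W t) (W t w)^† ∘ W t' w)^†.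
  by rewrite adj_sum; apply: eq_bigr => w _; rewrite adj_comp adjK VW.
rewrite (big_uniq_single (a := t)) ?undup_uniq //.
- by rewrite VWE W1 adj_idm.
- by move=> t' t't; rewrite VWE W0 // adj0 Phi0.
move=> tQ; rewrite -PhiE big1_seq // => w /andP[_ wt].
have tw : t \notin row_supp V w.
  apply: contra tQ => tw; rewrite mem_undup; apply/flattenP.
  by exists (row_supp V w) => //; exact: map_f.
by rewrite (entry_out tw) comp0m Phi0.
Qed.

(** On generators [g ∘ f] is conjugation by [V W = W^† W]; the sums collapse first on the codomain
    leg, then on the domain leg. *)
Lemma conj_cancel (J J' : eqType) (Y : J -> C) (Y' : J' -> C) (A A' : starAlg K)
    (gen : forall s t k, mor (X k ⊗ Y t) (Y s ⊗ X k) -> A)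
    (gen' : forall s t k, mor (X k ⊗ Y' t) (Y' s ⊗ X k) -> A')
    (pA : presents gen) (pA' : presents gen')
    (W : morMatrix Y Y') (V : morMatrix Y' Y)
    (f : {linear A -> A'}) (g : {linear A' -> A}) :
  (forall s t k x, f (@gen s t k x) = conj_gen gen' W s t k x) ->
  (forall s t k x, g (@gen' s t k x) = conj_gen gen V s t k x) ->
  (forall t w, V w t = (W t w)^†) -> isometric W -> cancel f g.
Proof.
move=> fE gE VW [W1 W0] a; elim/(gen_ind pA): a => [|a a' IH IH'|s t k x].
- by rewrite !linear0.
- by rewrite !linearD IH IH'.
rewrite fE /conj_gen (linear_sum g); under eq_bigr => w _ do rewrite (linear_sum g).
under eq_bigr => w _.
  under eq_bigr => w' _.
    rewrite gE /conj_gen.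
    under eq_bigr => t' _ do under eq_bigr => s' _ do rewrite act_comp.
    over.
  rewrite exchange_big /=.
  over.
have E w t' : \sum_(w' <- row_supp W s) \sum_(s' <- row_supp V w')
    @gen s' t' k (act (V w t' ∘ W t w) (V w' s' ∘ W s w') x) =
    @gen s t' k (act (V w t' ∘ W t w) (idm (Y s)) x).
  apply: (isometric_collapse (Phi := fun s' b => @gen s' t' k (act (V w t' ∘ W t w) b x))) => //.
  by move=> s' r F; rewrite act_sumr (linear_map_sum (gen_lin pA _ _ _)).
under eq_bigr => w _ do under eq_bigr => t' _ do rewrite E.
rewrite (isometric_collapse (Phi := fun t' a => @gen s t' k (act a (idm (Y s)) x))) //.
  by rewrite act1.
by move=> t' r F; rewrite act_suml (linear_map_sum (gen_lin pA _ _ _)).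
Qed.

(** As [V] is the adjoint of [W], the two isometry conditions say that [W] is unitary. [gen_lift]
    turns conjugation by [W] and by [V] into linear maps, which are mutually inverse. *)
Theorem presents_isomorphic (J J' : eqType) (Y : J -> C) (Y' : J' -> C) (A A' : starAlg K)
    (gen : forall s t k, mor (X k ⊗ Y t) (Y s ⊗ X k) -> A)
    (gen' : forall s t k, mor (X k ⊗ Y' t) (Y' s ⊗ X k) -> A')
    (W : morMatrix Y Y') (V : morMatrix Y' Y) :
  presents gen -> presents gen' -> (forall t w, V w t = (W t w)^†) ->
  isometric W -> isometric V -> star_isomorphic A A'.
Proof.
move=> pA pA' VW iW iV.
have [f fE] := gen_lift pA (conj_gen_lin pA' W).
have [g gE] := gen_lift pA' (conj_gen_lin pA V).
exists f; split.
- exists g; first exact: (conj_cancel pA pA' fE gE VW iW).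
  by apply: (conj_cancel pA' pA gE fE _ iV) => t w; rewrite VW adjK.
- exact: (conj_mul pA pA' fE iW).
- exact: (conj_star pA pA' fE).
Qed.

End Presentations.

(** * Universal property of direct sums *)

Section DirectSumTheory.
Context {K : nzRingType} {J : choiceType} {V : J -> lmodType K}.

Definition single_fun (j : J) (v : V j) (i : J) : V i :=
  if @eqP _ j i is ReflectT e then ecast i (V i) e v else 0.

Lemma single_funE j v : @single_fun j v j = v.
Proof. by rewrite /single_fun; case: eqP => // e; rewrite eq_axiomK. Qed.

Lemma single_fun_neq j v i : i != j -> @single_fun j v i = 0.
Proof. by rewrite /single_fun eq_sym; case: eqP. Qed.

Fact single_subproof j v : finite_set [set i | @single_fun j v i != 0].
Proof.
apply: (sub_finite_set _ (finite_set1 j)) => i /= nz; apply/eqP.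
by apply: contraNT nz => /single_fun_neq ->.
Qed.

Definition single j (v : V j) : dsum V := exist _ (single_fun v) (single_subproof v).

Lemma coord_single j (v : V j) : coord (single v) j = v.
Proof. exact: single_funE. Qed.

Lemma coord_single_neq j (v : V j) i : i != j -> coord (single v) i = 0.
Proof. exact: single_fun_neq. Qed.

Lemma single_linear j : linear (@single j).
Proof.
move=> c v w; apply: dsum_ext => i; rewrite coordD coordZ.
have [->|ij] := eqVneq i j; first by rewrite !coord_single.
by rewrite !coord_single_neq // scaler0 addr0.
Qed.

Lemma coord_sum (T : Type) (r : seq T) (F : T -> dsum V) j :
  coord (\sum_(t <- r) F t) j = \sum_(t <- r) coord (F t) j.
Proof. by elim: r => [|t r IH]; rewrite ?big_nil // !big_cons coordD IH. Qed.

Definition support (x : dsum V) : seq J := enum_fset (fset_set [set j | coord x j != 0]).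

Lemma support_out x j : j \notin support x -> coord x j = 0.
Proof.
rewrite in_fset_set; last exact: dsumP.
by move=> /negP nj; apply/eqP; apply: contra_notT nj => nz; rewrite inE.
Qed.

Lemma dsum_single x : x = \sum_(j <- support x) single (coord x j).
Proof.
apply: dsum_ext => i; rewrite coord_sum (big_uniq_single (a := i)) ?fset_uniq //.
- by rewrite coord_single.
- by move=> j ji; rewrite coord_single_neq // eq_sym.
- by move=> /support_out x0; rewrite coord_single.
Qed.

Section Lift.
Context {U : lmodType K} (phi : forall j, V j -> U).
Hypothesis phil : forall j : J, linear (@phi j).

Definition dsum_lift (x : dsum V) : U := \sum_(j \in [set: J]) @phi j (coord x j).

Lemma dsum_lift_finite x : finite_set [set j | @phi j (coord x j) != 0].
Proof.
apply: sub_finite_set (dsumP x) => j /=; apply: contraNneq => ->.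
by rewrite (linear_map0 (@phil j)).
Qed.

Lemma dsum_lift_linear : linear dsum_lift.
Proof.
move=> c x y; rewrite /dsum_lift -fsum_lin; try exact: dsum_lift_finite.
by apply: eq_fsbigr => j _; rewrite coordD coordZ phil.
Qed.

Lemma dsum_lift_single j (v : V j) : dsum_lift (single v) = @phi j v.
Proof.
rewrite /dsum_lift -(fsbig_widen [set j] setT) //=; last first.
  by move=> i [_ /= /eqP ij]; rewrite coord_single_neq // (linear_map0 (@phil i)).
by rewrite fsbig_set1 coord_single.
Qed.

End Lift.

Lemma dsum_lift_lincomb (U : lmodType K) (phi psi : forall j, V j -> U) c x :
  (forall j : J, linear (@phi j)) -> (forall j : J, linear (@psi j)) ->
  dsum_lift (fun j v => c *: @phi j v + @psi j v) x =
  c *: dsum_lift phi x + dsum_lift psi x.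
Proof. by move=> phil psil; rewrite /dsum_lift -fsum_lin; try exact: dsum_lift_finite. Qed.

End DirectSumTheory.

(** * [F(I) ⊗ AΛ] as the annular algebra of a repeated family *)

Section AnnularPresentation.
Context {K : numClosedFieldType} {C : cstarTensorCat K} (D : irrChoice C).
Variables (I : choiceType) (L : weightSet C).
Local Notation X := (irr D).
Local Notation V := (@annularMor _ _ D L).

Lemma annular_mul_single (i j s : L) (m l : Irr C)
    (x : V (s, j, m)) (y : V (i, s, l)) :
  annular_mul (single x) (single y) =
  \sum_(k <- constituents D m l) @single _ _ V (i, j, k) (mul_term k x y).
Proof.
apply: dsum_ext => -[[i' j'] k']; rewrite coord_annular_mul coord_sum /annular_mul_coord.
have S i0 j0 q : annular_summand (single x) (single y) i0 j0 k' q != 0 ->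
    [/\ q = (s, m, l), i0 = i & j0 = j].
  case: q => [[s' m'] l'] /annular_summand_neq0 [xs ys _].
  have [[-> -> ->]|/coord_single_neq x0] := eqVneq (s', j0, m') (s, j, m);
    last by rewrite x0 eqxx in xs.
  have [[-> _ ->]|/coord_single_neq y0] := eqVneq (i0, s', l') (i, s, l);
    last by rewrite y0 eqxx in ys.
  by [].
have [[-> ->]|ij] := eqVneq (i', j') (i, j); last first.
  rewrite fsbig1; last first.
    move=> q _; apply: contrapT => /eqP /S [_ ii jj].
    by rewrite ii jj eqxx in ij.
  rewrite big1 // => k _; rewrite coord_single_neq //.
  by apply: contra ij => /eqP [-> -> _].
rewrite -(fsbig_widen [set (s, m, l)] setT) //=; last first.
  by move=> q [_ /= qs]; apply: contrapT => /eqP nz; apply: qs; have [] := S _ _ _ nz.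
rewrite fsbig_set1 /= !coord_single.
rewrite (big_uniq_single (a := k')) ?fset_uniq ?coord_single //.
- by move=> k kk'; rewrite coord_single_neq //; apply: contra kk' => /eqP [->].
- by move=> /mul_term_out ->.
Qed.

Lemma annular_mul_single0 (i j i' j' : L) (m l : Irr C)
    (x : V (i, j, m)) (y : V (i', j', l)) : j' != i ->
  annular_mul (single x) (single y) = 0.
Proof.
move=> ji; apply: dsum_ext => -[[i0 j0] k0]; rewrite coord_annular_mul /annular_mul_coord.
rewrite fsbig1 // => -[[s m'] l'] _; apply: contrapT => /eqP /annular_summand_neq0 [xs ys _].
have [[si _ _]|/coord_single_neq x0] := eqVneq (s, j0, m') (i, j, m);
  last by rewrite x0 eqxx in xs.
have [[_ sj _]|/coord_single_neq y0] := eqVneq (i0, s, l') (i', j', l);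
  last by rewrite y0 eqxx in ys.
by rewrite -si -sj eqxx in ji.
Qed.

Lemma annular_star_single (i j : L) (k : Irr C) (x : V (i, j, bar D k)) :
  annular_star (single x) = @single _ _ V (j, i, k) (star_term x).
Proof.
apply: dsum_ext => -[[i' j'] k']; rewrite coord_annular_star.
have [[-> -> ->]|ne] := eqVneq (i', j', k') (j, i, k); first by rewrite !coord_single.
rewrite !coord_single_neq //; last first.
  by apply: contra ne => /eqP [-> -> /(can_inj (barK D)) ->].
have := annular_star_term_semilin (-1) (0 : V (j', i', bar D k')) 0.
by rewrite scaler0 addr0 rmorphN rmorph1 scaleN1r addNr => ->.
Qed.

Let T := (I * L)%type.
Let Y (t : T) : C := rep t.2.
Let A := tensorAlg (finMatrixAlg K I) (annularAlg D L).

(** The matrix unit records the copies and the annular component the weights. Matrix units list the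
    codomain first, annular coordinates the domain. *)
Definition tensor_gen (s t : T) k (x : mor (X k ⊗ Y t) (Y s ⊗ X k)) : A :=
  pure (munit K s.1 t.1) (@single _ _ V (t.2, s.2, k) x).

Lemma tensor_gen_ind (P : A -> Prop) : P 0 -> (forall a b, P a -> P b -> P (a + b)) ->
  (forall s t k x, P (@tensor_gen s t k x)) -> forall a, P a.
Proof.
have [pl pr] := @pure_bilinear _ (finMatrixAlg K I) (annularAlg D L).
move=> P0 PD Pg a; rewrite (tensor_span a); apply: big_ind => // -[b x] _ /=.
have [r ->] := munit_span b; rewrite (linear_map_sum (pl _)); apply: big_ind => // -[c [m n]] _ /=.
rewrite (dsum_single x) (linear_map_sum (pr _)); apply: big_ind => // -[[i j] k] _.
(* The coefficient of the matrix unit moves across the tensor sign into the morphism, so that the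
   term is a single generator. *)
have plZ := pl (single (coord x (i, j, k))) c (munit K m n) 0.
rewrite (linear_map0 (pl _)) !addr0 in plZ; rewrite plZ.
have prZ := pr (munit K m n) c (single (coord x (i, j, k))) 0.
rewrite (linear_map0 (pr _)) !addr0 in prZ; rewrite -prZ.
have sZ := @single_linear _ _ V (i, j, k) c (coord x (i, j, k)) 0.
rewrite (linear_map0 (@single_linear _ _ V _)) !addr0 in sZ; rewrite -sZ.
exact: (Pg (m, j) (n, i) k).
Qed.

Lemma tensor_gen_linear s t k : linear (@tensor_gen s t k).
Proof.
have [_ pr] := @pure_bilinear _ (finMatrixAlg K I) (annularAlg D L).
by move=> c x y; rewrite /tensor_gen single_linear pr.
Qed.

Lemma munitE (m n : I) :
  munit K m n = @single _ _ (fun _ : I * I => (K^o : lmodType K)) (m, n) (1 : K^o).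
Proof.
apply: dsum_ext => p; have [->|pn] := eqVneq p (m, n).
  by rewrite coord_munit coord_single !eqxx.
by case: p pn => p q pn; rewrite coord_single_neq // coord_munit -xpair_eqE (negbTE pn).
Qed.

(** The map is induced by the bilinear map that sends [(a, x)] to the sum over [p] of [a_p] times
    the value at [x] of the linear extension of [psi p]. *)
Lemma tensor_gen_lift (U : lmodType K)
    (phi : forall s t k, mor (X k ⊗ Y t) (Y s ⊗ X k) -> U) :
  (forall s t k, linear (@phi s t k)) ->
  exists h : {linear A -> U}, forall s t k x, h (@tensor_gen s t k x) = @phi s t k x.
Proof.
move=> phil.
pose psi (p : I * I) := fun (q : L * L * Irr C) (x : V q) =>
  @phi (p.1, q.1.2) (p.2, q.1.1) q.2 x.
have psil p q : linear (@psi p q).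
  by move=> c x y; exact: (phil (p.1, q.1.2) (p.2, q.1.1) q.2 c x y).
pose b (a : finMatrixAlg K I) (x : annularAlg D L) : U :=
  dsum_lift (fun p (c : K^o) => c *: dsum_lift (@psi p) x) a.
have bl x p : linear (fun c : K^o => c *: dsum_lift (@psi p) x).
  by move=> c d e; rewrite scalerDl scalerA.
have bb : is_bilinear b.
  split=> [x|a]; first exact: (dsum_lift_linear (bl x)).
  move=> c x y; rewrite /b -(dsum_lift_lincomb c a (bl x) (bl y)); apply: eq_fsbigr => p _ /=.
  by rewrite (dsum_lift_linear (psil p)) scalerDr !scalerA mulrC.
exists (linear_of (tensor_lift_linear bb)) => -[m i] [n j] k x.
rewrite [LHS](tensor_lift_pure _ _ bb) /b munitE (dsum_lift_single (bl _)) scale1r.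
by rewrite (dsum_lift_single (psil _)).
Qed.

Lemma tensor_presents : presents tensor_gen.
Proof.
split.
- exact: tensor_gen_linear.
- exact: tensor_gen_ind.
- exact: tensor_gen_lift.
- move=> [n j] [m i] [p h] k l x y; rewrite /tensor_gen amul_pure amul_munit eqxx scale1r.
  have [_ pr] := @pure_bilinear _ (finMatrixAlg K I) (annularAlg D L).
  by rewrite [amul _ _]annular_mul_single (linear_map_sum (pr _)).
- move=> [n j] [m i] [m' i'] [p h] k l x y ne; rewrite /tensor_gen amul_pure amul_munit /=.
  have [pl pr] := @pure_bilinear _ (finMatrixAlg K I) (annularAlg D L).
  have [mm|_] := eqVneq m m'; last by rewrite scale0r (linear_map0 (pl _)).
  rewrite [X in pure _ X]annular_mul_single0 ?(linear_map0 (pr _)) ?scaler0 //=.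
  by apply: contra ne => /eqP ->; rewrite mm.
- move=> [n j] [m i] k x; rewrite /tensor_gen astar_pure astar_munit.
  by rewrite [astar _]annular_star_single.
Qed.

End AnnularPresentation.

(** * Projections in the endomorphism algebras of non-simple objects *)

Lemma End_eigenvalue (K : numClosedFieldType) (V : vectType K) (f : 'End(V)) (x : V) :
  x != 0 -> exists c v, v != 0 /\ f v = c *: v.
Proof.
move=> x0; pose e := vbasis {:V}.
have d0 : (0 < \dim {:V})%N.
  rewrite lt0n dimv_eq0; apply: contra x0 => /eqP V0.
  by rewrite -memv0 -V0 memvf.
have [c ec] := eigenvalue_closed (passmx.mxof e e f) d0.
exists c; have : passmx.leigenspace f c != 0%VS.
  rewrite (passmx.leigenspaceE (e := e) (vbasisP _)).
  by rewrite (passmx.vsof_eq0 (vbasisP _)).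
rewrite -vpick0; set v := vpick _ => v0; exists v; split=> //.
have := memv_pick (passmx.leigenspace f c); rewrite memv_ker -/v.
by rewrite add_lfunE opp_lfunE scale_lfunE id_lfunE subr_eq0 => /eqP.
Qed.

Section Semisimple.
Context {K : numClosedFieldType} {C : cstarTensorCat K}.
Implicit Types X Y Z : C.

Lemma adj_opp X Y (f : mor X Y) : (- f)^† = - f^†.
Proof. by have := adj_semilin (-1) f 0; rewrite !addr0 adj0 addr0 rmorphN1 !scaleN1r. Qed.

Lemma adj_scale X Y c (f : mor X Y) : (c *: f)^† = Num.conj c *: f^†.
Proof. by have := adj_semilin c f 0; rewrite !addr0 adj0 addr0. Qed.

Lemma compNl X Y Z (f : mor Y Z) (g : mor X Y) : (- f) ∘ g = - (f ∘ g).
Proof. by rewrite -scaleN1r compZl scaleN1r. Qed.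

Lemma compNr X Y Z (f : mor Y Z) (g : mor X Y) : f ∘ (- g) = - (f ∘ g).
Proof. by rewrite -scaleN1r compZr scaleN1r. Qed.

(* By the C*-identity, a selfadjoint a satisfies ker a ∩ im a = 0 for its action on
   End(Y), hence End(Y) = ker a ⊕ im a; the kernel component of the identity is
   the projection. *)
Lemma selfadjoint_kernel_projection Y (a y : mor Y Y) :
  a^† = a -> a != 0 -> y != 0 -> a ∘ y = 0 ->
  exists p : mor Y Y, [/\ p ∘ p = p, p^† = p, p != 0 & p != idm Y].
Proof.
move=> aa a0 y0 ay; pose f : 'End(mor Y Y) := linfun (linear_of (comp_linr a)).
have fE x : f x = a ∘ x by rewrite lfunE.
have kI : (lker f :&: limg f = 0)%VS.
  apply/eqP; rewrite -subv0; apply/subvP => z; rewrite memv_cap memv_ker memv0.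
  move=> /andP[/eqP fz /memv_imgP [x _ zE]]; apply/eqP; apply: adj_comp_eq0.
  by rewrite {1}zE fE adj_comp aa -compA -fE fz compm0.
have /memv_addP [p pk [u /memv_imgP [x _ uE] pu]] : idm Y \in (lker f + limg f)%VS.
  suff -> : (lker f + limg f = fullv)%VS by exact: memvf.
  apply/eqP; rewrite eqEdim subvf dimv_disjoint_sum //.
  by rewrite -(limg_ker_dim f fullv) capfv leqnn.
have ap : a ∘ p = 0 by apply/eqP; rewrite -fE -memv_ker.
rewrite uE fE in pu.
have pa : p^† ∘ a = 0 by rewrite -[a]aa -adj_comp ap adj0.
have pp : p^† = p^† ∘ p.
  by rewrite -[LHS]compm1 pu compDr compA pa comp0m addr0.
have ps : p^† = p by rewrite -[RHS]adjK pp adj_comp adjK -pp.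
exists p; split=> //.
- by rewrite -{1}ps -pp ps.
- apply: contraNneq y0 => p0; rewrite -(adjK y) -[y^†]compm1 pu p0 add0r compA.
  by rewrite -{1}[a]aa -adj_comp ay adj0 comp0m adj0.
- by apply: contraNneq a0 => p1; rewrite -[a]compm1 -p1 ap.
Qed.

(** Some selfadjoint [h] is not scalar, since otherwise real and imaginary parts would make every
    endomorphism scalar. For an eigenvalue [c] of left composition with [h], the element [h - c] is
    selfadjoint, nonzero, and kills some [y != 0]. *)
Lemma nonsimple_projection Y : idm Y != 0 -> ~ simple Y ->
  exists p : mor Y Y, [/\ p ∘ p = p, p^† = p, p != 0 & p != idm Y].
Proof.
move=> Y0 nY.
have [h hh nh] : exists2 h : mor Y Y, h^† = h & forall c, h != c *: idm Y.
  apply: contrapT => nsa; apply: nY; split=> // f.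
  have S h : h^† = h -> exists c, h = c *: idm Y.
    move=> hh; apply: contrapT => nc; apply: nsa; exists h => // c.
    by apply/eqP => hc; apply: nc; exists c.
  have [|c cE] := S (f + f^†); first by rewrite adj_add adjK addrC.
  have [|d dE] := S ('i *: (f - f^†)).
    by rewrite adj_scale adj_add adj_opp adjK conjCi scaleNr -scalerN opprD opprK addrC.
  (* With [f + f^† = c] and [i (f - f^†) = d] as multiples of the identity, [2 f = c - i d]. *)
  exists (2^-1 * (c - 'i * d)).
  rewrite -scalerA scalerBl -scalerA -cE -dE scalerA.
  rewrite -expr2 sqrCi scaleN1r opprK addrACA subrr addr0 -mulr2n -scaler_nat.
  by rewrite scalerA mulVf ?scale1r // pnatr_eq0.
have [c [y [y0 hy]]] := End_eigenvalue (linfun (linear_of (comp_linr h))) Y0.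
rewrite lfunE /= in hy.
have yy0 : y^† ∘ y != 0 by apply: contraNneq y0 => /adj_comp_eq0 ->.
have cr : Num.conj c = c.
  have : (h ∘ y)^† ∘ y = y^† ∘ (h ∘ y) by rewrite adj_comp hh compA.
  rewrite hy adj_scale compZl compZr => /eqP; rewrite -subr_eq0 -scalerBl scaler_eq0.
  by rewrite (negbTE yy0) orbF subr_eq0 => /eqP.
apply: (@selfadjoint_kernel_projection Y (h - c *: idm Y) y) => //.
- by rewrite adj_add adj_opp adj_scale adj_idm cr hh.
- by rewrite subr_eq0.
- by rewrite compDl compNl hy compZl comp1m subrr.
Qed.

End Semisimple.

(** * Decomposition of objects into simple objects *)

Section Decomposition.
Context {K : numClosedFieldType} {C : cstarTensorCat K} (D : irrChoice C).
Local Notation X := (irr D).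
Implicit Types Y Z : C.

Definition orthonormal Z Y (s : seq (mor Z Y)) :=
  forall p q, (p < size s)%N -> (q < size s)%N ->
    (s`_p)^† ∘ s`_q = (q == p)%:R *: idm Z.

Record decomposes Y (e : forall k, seq (mor (X k) Y)) (F : seq (Irr C)) : Prop :=
  Decomposes {
    dec_orth : forall k, orthonormal (e k);
    dec_uniq : uniq F;
    dec_out : forall k, k \notin F -> e k = [::];
    dec_sum : \sum_(k <- F) \sum_(v <- e k) v ∘ v^† = idm Y }.

Lemma simple_iso Y Z : isomorphic Y Z -> simple Y -> simple Z.
Proof.
move=> [f [g [gf fg]]] [Y0 sY]; split.
  apply: contraNneq Y0 => Z0; rewrite -gf -[f]comp1m Z0 comp0m compm0.
  exact: eqxx.
move=> h; have [c cE] := sY (g ∘ h ∘ f); exists c.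
have -> : h = f ∘ (g ∘ h ∘ f) ∘ g by rewrite !compA fg comp1m -compA fg compm1.
by rewrite cE compZr compm1 compZl fg.
Qed.

Lemma irr_exhaustive Y : simple Y -> exists k : Irr C, isomorphic (X k) Y.
Proof.
move=> sY; have sk : [set Z | isomorphic Y Z] `<=` simple.
  by move=> Z YZ; exact: simple_iso YZ sY.
pose k0 : isoclass C := IsoClass (ex_intro _ Y erefl).
have k0I : k0 \in Irr C by rewrite inE.
exists (SigSub k0I); apply: isomorphic_sym.
exact: (irrP D (SigSub k0I)).
Qed.

(** By positivity the scalar [f^† ∘ f] is [h^† ∘ h] with [h] a scalar [d], so it equals [|d|^2] and
    [d^-1 *: f] is unitary. *)
Lemma simple_iso_unitary Y Z : isomorphic Y Z -> simple Y ->
  exists u : mor Y Z, u^† ∘ u = idm Y /\ u ∘ u^† = idm Z.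
Proof.
move=> [f [g [gf fg]]] [Y0 sY].
have [h hE] := adj_comp_pos f; have [d dE] := sY h.
rewrite dE adj_scale adj_idm compZl compZr compm1 scalerA in hE.
have d0 : d != 0.
  apply: contraNneq Y0 => d0; move: hE; rewrite d0 mulr0 scale0r => /adj_comp_eq0 f0.
  by rewrite -gf f0 compm0.
pose u := d^-1 *: f.
have uu : u^† ∘ u = idm Y.
  rewrite /u adj_scale compZl compZr hE !scalerA fmorphV mulrACA.
  by rewrite !mulVf ?mulr1 ?scale1r ?fmorph_eq0.
exists u; split=> //.
have ug : u ∘ (d *: g) = idm Z by rewrite /u compZl compZr scalerA mulVf // fg scale1r.
by rewrite -[u^†]compm1 -{1}ug !compA -[u ∘ _ ∘ _]compA uu compm1 ug.
Qed.

(** The map [x ↦ v ∘ x ∘ v^†] embeds [End(Z)] into [End(Y)]. If it were onto, then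
    [idm Y = v ∘ x ∘ v^†] for some [x], which forces [v ∘ v^† = idm Y]. *)
Lemma isometry_dim_lt Y Z (v : mor Z Y) : isometry v -> v ∘ v^† != idm Y ->
  (\dim {:mor Z Z} < \dim {:mor Y Y})%N.
Proof.
move=> vv vn.
have fl : linear (fun x : mor Z Z => v ∘ x ∘ v^†) by move=> c x y; rewrite compPr compPl.
pose f : 'Hom(mor Z Z, mor Y Y) := linfun (linear_of fl).
have fE x : f x = v ∘ x ∘ v^† by rewrite lfunE.
have f0 : lker f = 0%VS.
  apply/eqP; rewrite -subv0; apply/subvP => x; rewrite memv_ker memv0 fE => /eqP x0.
  have := congr1 (fun z => v^† ∘ z ∘ v) x0.
  by rewrite compm0 comp0m !compA vv comp1m -compA vv compm1 => ->.
have := limg_ker_dim f fullv; rewrite f0 capv0 dimv0 add0n => <-.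
rewrite ltn_neqAle dimvS ?subvf // andbT.
apply: contra vn => /eqP dE.
have /memv_imgP [x _ xE] : idm Y \in limg f.
  have -> : limg f = fullv by apply/eqP; rewrite eqEdim subvf dE leqnn.
  exact: memvf.
rewrite fE in xE; apply/eqP.
by rewrite -[LHS]compm1 {1}xE -!compA (compA v^†) vv comp1m compA -xE.
Qed.

(** Induction on the dimension of [End(Y)]: a projection and its complement split a non-simple [Y]
    into two subobjects with smaller endomorphism spaces, and their bases are joined. *)
Lemma decomposition Y : exists e F, @decomposes Y e F.
Proof.
have [n] := ubnP (\dim {:mor Y Y}); elim: n Y => // n IH Y; rewrite ltnS => dY.
have [Y0|Y0] := eqVneq (idm Y) 0.
  exists (fun=> [::]), [::]; split=> //; by rewrite big_nil Y0.
have [sY|nY] := pselect (simple Y).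
  have [k0 k0Y] := irr_exhaustive sY.
  (* [e] is a dependent family over all [k]; choosing inside [U k], which is nonempty for [k0]
     alone, avoids transport along [k = k0]. *)
  pose U k := [set u : mor (X k) Y | u^† ∘ u = idm _ /\ u ∘ u^† = idm _].
  have U0 : U k0 !=set0.
    by have [u uu] := simple_iso_unitary k0Y (irr_simple D k0); exists u.
  have UE k : k != k0 -> ~ (U k !=set0).
    move=> /eqP kk0 [u [u1 u2]]; apply: kk0; apply: (irr_inj (D := D)).
    by apply: isomorphic_trans (isomorphic_sym k0Y); exists u, u^†.
  pose e k : seq (mor (X k) Y) := if `[< U k !=set0 >] then [:: xget 0 (U k)] else [::].
  have UP k : U k !=set0 -> U k (xget 0 (U k)) by move=> /set0P; move/set0P=> [u]; exact: xgetI.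
  exists e, [:: k0]; split=> // [k p q|k|].
  - rewrite /e; case: asboolP => // /UP [uu _] /=.
    by case: p q => [|//] [|//] _ _; rewrite scale1r.
  - by rewrite inE /e => /UE; case: asboolP.
  by rewrite big_seq1 /e asboolT // big_seq1; have [_] := UP _ U0.
have [p [pp ps p0 p1]] := nonsimple_projection Y0 nY.
have [Z [v [vv vp]]] := subobjects pp ps.
have qq : (idm Y - p) ∘ (idm Y - p) = idm Y - p.
  by rewrite compDl compNl !compDr !compNr !comp1m compm1 pp subrr subr0.
have qs : (idm Y - p)^† = idm Y - p by rewrite adj_add adj_opp adj_idm ps.
have [Z' [v' [vv' vp']]] := subobjects qq qs.
have v0 : v^† ∘ v' = 0.
  have e1 : v^† ∘ p = v^† by rewrite -vp compA vv comp1m.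
  have e2 : (idm Y - p) ∘ v' = v' by rewrite -vp' -compA vv' compm1.
  by rewrite -e1 -e2 -compA (compA p) compDr compNr compm1 pp subrr comp0m compm0.
have v0' : v'^† ∘ v = 0 by rewrite -[LHS]adjK adj_comp adjK v0 adj0.
have [e [F eF]] : exists e F, @decomposes Z e F.
  by apply: IH; apply: leq_trans dY; apply: (isometry_dim_lt vv); rewrite vp.
have [e' [F' eF']] : exists e F, @decomposes Z' e F.
  apply: IH; apply: leq_trans dY; apply: (isometry_dim_lt vv'); rewrite vp'.
  by rewrite -subr_eq0 addrAC subrr add0r oppr_eq0.
exists (fun k => [seq v ∘ f | f <- e k] ++ [seq v' ∘ f | f <- e' k]), (undup (F ++ F')).
split.
- move=> k i j; rewrite !size_cat !size_map !nth_cat !size_map => si sj.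
  have [ik|ik] := ltnP i (size (e k)); have [jk|jk] := ltnP j (size (e k)).
  + rewrite !(nth_map 0) // adj_comp -compA (compA v^†) vv comp1m; exact: (dec_orth eF).
  + rewrite !(nth_map 0) // ?ltn_subLR // adj_comp -compA (compA v^†) v0 comp0m compm0.
    by rewrite gtn_eqF ?scale0r // (leq_trans ik).
  + rewrite !(nth_map 0) // ?ltn_subLR // adj_comp -compA (compA v'^†) v0' comp0m compm0.
    by rewrite ltn_eqF ?scale0r // (leq_trans jk).
  rewrite !(nth_map 0) // ?ltn_subLR // adj_comp -compA (compA v'^†) vv' comp1m.
  rewrite (dec_orth eF') ?ltn_subLR //.
  by rewrite -(eqn_add2r (size (e k))) !subnK.
- exact: undup_uniq.
- move=> k; rewrite mem_undup mem_cat negb_or => /andP[kF kF'].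
  by rewrite (dec_out eF kF) (dec_out eF' kF').
under eq_bigr => k _ do rewrite big_cat !big_map.
rewrite big_split /= -(big_uniq_widen (dec_uniq eF)) ?undup_uniq //; first last.
- by move=> k /(dec_out eF) ->; rewrite big_nil.
- by move=> k kF; rewrite mem_undup mem_cat kF.
rewrite -[X in _ + X](big_uniq_widen (dec_uniq eF')) ?undup_uniq //; first last.
- by move=> k /(dec_out eF') ->; rewrite big_nil.
- by move=> k kF; rewrite mem_undup mem_cat kF orbT.
have conjE (T : C) (w : mor T Y) (g : forall k, seq (mor (X k) T)) G :
    \sum_(k <- G) \sum_(f <- g k) (w ∘ f) ∘ (w ∘ f)^† =
    w ∘ (\sum_(k <- G) \sum_(f <- g k) f ∘ f^†) ∘ w^†.
  rewrite comp_sumr comp_suml; apply: eq_bigr => k _.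
  by rewrite comp_sumr comp_suml; apply: eq_bigr => f _; rewrite adj_comp !compA.
by rewrite !conjE (dec_sum eF) (dec_sum eF') !compm1 vp vp' addrC subrK.
Qed.

(** Schur's lemma: a nonzero composite would make [X_k'] and [X_k] isomorphic. *)
Lemma orthonormal_cross Y (k k' : Irr C) (f : mor (X k) Y) (g : mor (X k') Y) :
  k != k' -> f^† ∘ g = 0.
Proof.
move=> kk'; apply: contrapT => /eqP fg; case/eqP: kk'; apply: esym.
exact: irr_inj (simple_nonzero_iso (irr_simple D k') (irr_simple D k) fg).
Qed.

(** If no copy of [X_k] occurred, composing [v] with the decomposition of [idm Y] would give [v = 0]
    by Schur's lemma, yet an isometry out of a simple object is nonzero. *)
Lemma subobject_multiplicity Y e F k : @decomposes Y e F -> subobject (X k) Y ->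
  (0 < size (e k))%N.
Proof.
move=> eF [v vv]; rewrite lt0n size_eq0; apply/eqP => e0.
have [k0 _] := irr_simple D k; case/eqP: k0.
rewrite -vv; suff -> : v = 0 by rewrite compm0.
rewrite -[v]comp1m -(dec_sum eF) comp_suml big1 // => k' _.
rewrite comp_suml big1_seq // => f /andP[_].
have [kk'|kk' _] := eqVneq k' k; first by subst k'; rewrite e0.
by rewrite -compA orthonormal_cross // compm0.
Qed.

(** The bases are matched position by position; orthonormality of [e'] reduces the composite to the
    decomposition of [idm Y] by [e]. *)
Lemma decomposition_match Y Y' e e' F : @decomposes Y e F -> @decomposes Y' e' F ->
  (forall k, size (e k) = size (e' k)) ->
  (\sum_(k <- F) \sum_(0 <= p < size (e' k)) (e k)`_p ∘ ((e' k)`_p)^†) ∘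
  (\sum_(k <- F) \sum_(0 <= p < size (e k)) (e' k)`_p ∘ ((e k)`_p)^†) = idm Y.
Proof.
move=> eF eF' se; rewrite -(dec_sum eF) comp_sumr.
apply: eq_big_seq => k kF.
rewrite comp_suml (big_uniq_single (a := k)) ?(dec_uniq eF) //; first last.
- by rewrite kF.
- move=> k' k'k; rewrite comp_suml big1 // => p _; rewrite comp_sumr big1 // => q _.
  by rewrite compA -(compA _ (_`_p)^†) orthonormal_cross // compm0 comp0m.
rewrite comp_suml [RHS](big_nth 0) se; apply: eq_big_nat => p /= ps.
rewrite comp_sumr (big_uniq_single (a := p)) ?iota_uniq //.
- by rewrite compA -(compA _ (_`_p)^†) (dec_orth eF') // eqxx scale1r compm1.
- move=> q qp; have [qs|qs] := ltnP q (size (e' k)).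
    rewrite compA -(compA _ (_`_p)^†) (dec_orth eF') // (negbTE qp).
    by rewrite scale0r compm0 comp0m.
  by rewrite (nth_default 0 qs) comp0m compm0.
- by rewrite mem_index_iota ps.
Qed.

Lemma isomorphic_multiplicities Y Y' e e' F : @decomposes Y e F -> @decomposes Y' e' F ->
  (forall k, size (e k) = size (e' k)) -> isomorphic Y Y'.
Proof.
move=> eF eF' se; do 2 eexists; split; first exact: (decomposition_match eF eF').
exact: (decomposition_match eF' eF).
Qed.

End Decomposition.

(** * Countability of the weight set *)

Lemma isoclass_eq (K : numClosedFieldType) (C : cstarTensorCat K) (a b : isoclass C) (Y Z : C) :
  members a Y -> members b Z -> isomorphic Y Z -> a = b.
Proof.
have [A Aa] := membersP a; have [B Bb] := membersP b.
rewrite Aa Bb /= => AY BZ YZ; apply: isoclass_ext; rewrite Aa Bb.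
have AB := isomorphic_trans AY (isomorphic_trans YZ (isomorphic_sym BZ)).
apply/seteqP; split=> T /=; apply: isomorphic_trans => //.
exact: isomorphic_sym.
Qed.

Section Weights.
Context {K : numClosedFieldType} {C : cstarTensorCat K} (D : irrChoice C) (L : weightSet C).
Local Notation X := (irr D).

Definition weight_basis (i : L) : forall k, seq (mor (X k) (rep i)) :=
  sval (cid (decomposition D (rep i))).

Definition weight_types (i : L) : seq (Irr C) :=
  sval (cid (svalP (cid (decomposition D (rep i))))).

Lemma weight_decomposes i : decomposes (weight_basis i) (weight_types i).
Proof. exact: (svalP (cid (svalP (cid (decomposition D (rep i)))))). Qed.

(* A weight is determined by the multiplicities of the simple objects in it, hence
   by a finite sequence in Irr(C) × nat. *)
Lemma weights_countable : countable (Irr C) -> countable [set: L].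
Proof.
move=> /countable_injP [nu nuI].
pose code i := [seq (nu (val k), size (weight_basis i k)) | k <- weight_types i].
apply/countable_injP; exists (choice.pickle \o code) => i j _ _ /= /(pcan_inj choice.pickleK) ij.
have Fij : weight_types i = weight_types j.
  apply: (@inj_map _ _ (fun k : Irr C => nu (val k))).
    by move=> k k' /nuI kk'; apply/val_inj/kk'; exact: valP.
  by have := congr1 (map fst) ij; rewrite -!map_comp.
have eqF := weight_decomposes i; have := weight_decomposes j; rewrite -Fij => eqF'.
have sij k : size (weight_basis i k) = size (weight_basis j k).
  have [kF|kF] := boolP (k \in weight_types i); last by rewrite (dec_out eqF kF) (dec_out eqF' kF).
  by move: ij; rewrite /code -Fij => /eq_in_map /(_ k kF) [].
apply: val_inj; apply: (isoclass_eq (repP i) (repP j)).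
exact: (isomorphic_multiplicities eqF eqF').
Qed.

End Weights.

(** * Matching of simple constituents and the unitary matrix *)

Lemma card_eq_param (I T : Type) (S : set T) (m0 : I) : ([set: I] #= S)%card ->
  exists (b : I -> T) (g : T -> I),
    [/\ forall m, S (b m), cancel b g & forall x, S x -> b (g x) = x].
Proof.
move=> /card_bijP [f [f' fK f'K]].
exists (fun m => val (f (SigSub (in_setT m)))).
(* [m0] is a default value outside [S], where nothing is claimed about [g]. *)
exists (fun x => if pselect (S x) is left Sx then val (f' (SigSub (mem_set Sx))) else m0).
split.
- by move=> m; exact: set_mem (valP _).
- move=> m; case: pselect => [Sx|]; last by case; exact: set_mem (valP _).
  have -> : SigSub (mem_set Sx) = f (SigSub (in_setT m)) by exact: val_inj.
  by rewrite fK.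
- move=> x Sx; case: pselect => // Sx'.
  have -> : SigSub (in_setT (val (f' (SigSub (mem_set Sx'))))) = f' (SigSub (mem_set Sx')).
    exact: val_inj.
  by rewrite f'K.
Qed.

Section Matching.
Context {K : numClosedFieldType} {C : cstarTensorCat K} (D : irrChoice C) (L : weightSet C).
Context {I : choiceType}.
Hypotheses (hIrr : countable (Irr C)) (hL : full L).
Hypothesis hI : ([set: I] #= [set: nat])%card.
Local Notation X := (irr D).
Local Notation e := (@weight_basis _ _ D L).

(* The occurrences of X_k in the family that repeats every weight I times: copy,
   weight, and position in an orthonormal basis of Mor(X_k, Y_i). *)
Definition slots (k : Irr C) : set (I * L * nat) := [set x | (x.2 < size (e x.1.2 k))%N].

(** Slots are triples of countable data. They are infinite in number because fullness gives a weight
    containing [X_k], and its position 0 occurs once for each copy in [I]. *)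
Lemma slots_card k : ([set: I] #= slots k)%card.
Proof.
apply: card_eq_trans hI _; rewrite card_eq_sym; apply: eq_card_nat.
  apply: (@sub_countable _ _ _ (([set: I] `*` [set: L]) `*` [set: nat])).
    by apply: subset_card_le => -[[n i] p].
  apply: countableX => //; apply: countableX; last exact: weights_countable hIrr.
  by move: hI; rewrite card_eq_le => /andP[].
have [i ki] := hL (irr_simple D k).
have s0 := subobject_multiplicity (weight_decomposes D i) ki.
move=> /(finite_preimage (f := fun n : I => (n, i, 0%N))) => fS.
apply: infinite_nat; rewrite -(eq_finite_set hI).
have -> : [set: I] = (fun n : I => (n, i, 0%N)) @^-1` slots k by apply/seteqP; split.
by apply: fS => m n _ _ [].
Qed.

Lemma matching_exists : exists (b : Irr C -> I -> I * L * nat) (g : Irr C -> I * L * nat -> I),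
  forall k, [/\ forall m, slots k (b k m), cancel (b k) (g k) &
    forall x, slots k x -> b k (g k x) = x].
Proof.
have [m0 _] : [set: I] !=set0.
  apply/set0P/negP => /eqP I0; apply: infinite_nat.
  by rewrite -(eq_finite_set hI) I0.
have /choice [b /choice [g bg]] := fun k => card_eq_param m0 (slots_card k).
by exists b, g.
Qed.

(** If [(m, k)] is matched with the slot [(n, i, p)], its row has a single nonzero entry, at
    [(n, i)]: the basis vector of index [p] in [Mor(X_k, Y_i)]. Orthonormality and injectivity of
    the matching make [W] an isometry, completeness and surjectivity make [V] one. *)
Lemma unitary_exists :
  exists (W : morMatrix (fun t : I * irrWeight D => rep t.2) (fun w : I * L => rep w.2))
    (V : morMatrix (fun w : I * L => rep w.2) (fun t : I * irrWeight D => rep t.2)),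
    [/\ forall t w, V w t = (W t w)^†, isometric W & isometric V].
Proof.
have [b [g bg]] := matching_exists.
pose w0 (t : I * irrWeight D) := (b t.2 t.1).1.
pose W (t : I * irrWeight D) (w : I * L) : mor (X t.2) (rep w.2) :=
  if w0 t == w then (e w.2 t.2)`_(b t.2 t.1).2 else 0.
(* The support of column [w]: the slots in [w], pulled back along the matching, finite because the
   decomposition of a weight is. *)
pose r (w : I * L) : seq (I * irrWeight D) :=
  [seq (g k (w, p), k) | k <- weight_types D w.2, p <- iota 0 (size (e w.2 k))].
have W0 t w : w0 t != w -> W t w = 0 by rewrite /W => /negbTE ->.
have r_uniq w : uniq (r w).
  apply: allpairs_uniq_dep.
  - exact: (dec_uniq (weight_decomposes D w.2)).
  - by move=> k _; exact: iota_uniq.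
  move=> _ _ /allpairsPdep [k [p [_ kp ->]]] /allpairsPdep [k' [p' [_ kp' ->]]] /= [gg kk'].
  subst k'; move: kp kp'; rewrite !mem_iota /= => kp kp'.
  have [_ _ bK] := bg k.
  by have := congr1 (b k) gg; rewrite !bK // => -[->].
have W_out t w : w \notin [:: w0 t] -> W t w = 0 by rewrite inE eq_sym => /W0.
have V_out w t : t \notin r w -> (W t w)^† = 0.
  have [<-|/W0 ->] := eqVneq (w0 t) w; last by rewrite adj0.
  case: t => m k /negP[]; have [bS bK _] := bg k.
  apply/allpairsPdep; exists k, (b k m).2; split.
  - apply/negPn/negP => /(dec_out (weight_decomposes D _)) k0.
    by have := bS m; rewrite /slots /= k0.
  - by rewrite mem_iota /=; exact: bS.
  - by rewrite /w0 /= -surjective_pairing bK.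
pose WM := @MorMatrix _ _ _ _ (fun t : I * irrWeight D => rep t.2) (fun w : I * L => rep w.2)
  W (fun t => [:: w0 t]) (fun=> isT) W_out.
pose VM := @MorMatrix _ _ _ _ (fun w : I * L => rep w.2) (fun t : I * irrWeight D => rep t.2)
  (fun w t => (W t w)^†) r r_uniq V_out.
exists WM, VM; split=> //; split=> /=.
- move=> [m k]; rewrite big_seq1 /W eqxx; have [bS _ _] := bg k.
  by rewrite (dec_orth (weight_decomposes D _)) ?eqxx ?scale1r //; exact: bS.
- move=> [m k] [m' k'] ne; rewrite big_seq1.
  have [ww|/W0 ->] := eqVneq (w0 (m, k)) (w0 (m', k')); last by rewrite compm0.
  rewrite /W ww eqxx /=; have [kk|kk] := eqVneq k' k; last exact: orthonormal_cross.
  subst k'; have [bS bK _] := bg k.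
  have bS1 := bS m; rewrite /slots /= -/(w0 (m, k)) ww in bS1.
  rewrite (dec_orth (weight_decomposes D _)) //; last exact: bS.
  have [pp|_] := eqVneq (b k m).2 (b k m').2; last by rewrite scale0r.
  (* Same copy, weight and position mean the same slot, hence the same index. *)
  case/eqP: ne; congr (_, _); apply: (can_inj bK).
  by rewrite [LHS]surjective_pairing pp -/(w0 (m, k)) ww -surjective_pairing.
(* Down column [w] the entries run through the bases for all constituents, so the sum is the
   decomposition of the identity. *)
- move=> w; rewrite big_allpairs_dep -[RHS](dec_sum (weight_decomposes D w.2)).
  apply: eq_big_seq => k _; rewrite [RHS](big_nth 0) /index_iota subn0.
  apply: eq_big_seq => p; rewrite mem_iota /= => ps.
  have [_ _ bK] := bg k.
  by rewrite adjK /W /w0 /= bK //= eqxx.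
- move=> w w' ww'; rewrite big1 // => t _; rewrite adjK.
  have [tw|/W0 ->] := eqVneq (w0 t) w; last by rewrite adj0 compm0.
  by rewrite (W0 t w') ?comp0m // tw.
Qed.

Theorem stable_isomorphism :
  star_isomorphic
    (tensorAlg (finMatrixAlg K I) (tubeAlg D))
    (tensorAlg (finMatrixAlg K I) (annularAlg D L)).
Proof.
have [W [V [VW iW iV]]] := unitary_exists.
exact: (presents_isomorphic (tensor_presents D I (irrWeight D)) (tensor_presents D I L) VW iW iV).
Qed.

End Matching.

(** * The isomorphism over the complex numbers *)

Theorem proposition3p5 (R : realType) (C : cstarTensorCat R[i])
    (D : irrChoice C) (L : weightSet C) (I : choiceType)
    (hC : rigid C) (hIrr : countable (Irr C)) (hL : full L)
    (hI : ([set: I] #= [set: nat])%card) :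
  star_isomorphic
    (tensorAlg (finMatrixAlg R[i] I) (tubeAlg D))
    (tensorAlg (finMatrixAlg R[i] I) (annularAlg D L)).
Proof. exact: stable_isomorphism. Qed.
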